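(* Suppose a local two-qubit unital noise $\Upsilon(t)\otimes\Upsilon'(t)$, with the matrix representations of $\Upsilon(t)$ and $\Upsilon'(t)$ being diagonal in the basis of Pauli operators $\sigma_1,\sigma_2,\sigma_3$. Then the state with ultimate entanglement robustness is the maximally entangled state $$|\psi_{\Upsilon\otimes\Upsilon'}\rangle=\tfrac{1}{\sqrt2}\big(|\varphi\rangle\otimes|\chi\rangle+|\varphi_\perp\rangle\otimes|\chi_\perp\rangle\big),$$ where $\{|\varphi\rangle,|\varphi_\perp\rangle\}$ and $\{|\chi\rangle,|\chi_\perp\rangle\}$ are orthogonal eigenvectors of some Pauli operators ($\sigma_1$, or $\sigma_2$, or $\sigma_3$).
   Context: $\sigma_1,\sigma_2,\sigma_3$ are the Pauli operators, $\sigma_0=I$ is the $2\times2$ identity, $\mathrm{Id}$ is the identity map. A qubit channel is a completely positive trace-preserving linear map on $2\times2$ complex matrices; it is unital if it maps $I$ to $I$. The matrix representation of a linear map $\Upsilon$ on $2\times2$ matrices is $M_{ij}(\Upsilon)=\tfrac12\mathrm{tr}\big[\sigma_i\Upsilon[\sigma_j]\big]$, $i,j=0,\dots,3$; here $M(\Upsilon(t))=\mathrm{diag}(1,\lambda_1(t),\lambda_2(t),\lambda_3(t))$ and $M(\Upsilon'(t))=\mathrm{diag}(1,\lambda_1'(t),\lambda_2'(t),\lambda_3'(t))$. A local two-qubit unital noise is a family $\Upsilon(t)\otimes\Upsilon'(t)$, $t\geqslant0$, of tensor products of unital qubit channels with $\Upsilon(0)=\Upsilon'(0)=\mathrm{Id}$.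 A two-qubit density operator is entangled if it does not belong to the closure of the set of separable states $\sum_kp_k\varrho_k^A\otimes\varrho_k^B$, $p_k\geqslant0$, $\sum_kp_k=1$, with $\varrho_k^A,\varrho_k^B$ qubit density operators. Given a local noise $\Phi_1(t)\otimes\Phi_2(t)$, the entanglement lifetime of an input two-qubit state $\varrho$ is the minimal time $\tau$ such that $(\Phi_1(t)\otimes\Phi_2(t))[\varrho]$ is separable for all $t\geqslant\tau$. The maximal entanglement lifetime is $\widetilde\tau=\max_\varrho\tau$ over all two-qubit input states, and the state which maximizes the entanglement lifetime is said to exhibit ultimate entanglement robustness to the noise. A pure state $|\psi\rangle$ is identified with the density operator $|\psi\rangle\langle\psi|$. *)

(* Defs.v *)
From HB Require Import structures.
From mathcomp Require Import all_boot all_order all_algebra.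
From mathcomp Require Import all_classical all_reals all_analysis.
From mathcomp Require Export complex mxtens.

Set Implicit Arguments.
Unset Strict Implicit.
Unset Printing Implicit Defensive.

Import Order.TTheory GRing.Theory Num.Theory numFieldNormedType.Exports.
Local Open Scope ring_scope.
Local Open Scope complex_scope.
Local Open Scope classical_set_scope.
Local Open Scope sesquilinear_scope.

Section Operators.
Variable R : realType.
Local Notation C := R[i].

Definition cdot n (u v : 'cV[C]_n) : C := (u^t* *m v) 0 0.

Definition ketbra n (v : 'cV[C]_n) : 'M[C]_n := v *m v^t*.

(* In [R[i]], [0 <= z] says that [z] is real and nonnegative, so [A] is
   Hermitian by polarization. *)
Definition psd n (A : 'M[C]_n) : Prop :=
  forall v : 'cV[C]_n, 0 <= cdot v (A *m v).

Definition density n (A : 'M[C]_n) : Prop := psd A /\ \tr A = 1.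

(* The linear map [X |-> (F (x) G)[X]], computed on the matrix units; see
   [tensmap_tens]. *)
Definition tensmap m n p q (F : 'M[C]_m -> 'M[C]_n) (G : 'M[C]_p -> 'M[C]_q)
    (X : 'M[C]_(m * p)) : 'M[C]_(n * q) :=
  \sum_i \sum_j \sum_k \sum_l
    X (mxtens_index (i, k)) (mxtens_index (j, l)) *:
      (F (delta_mx i j) *t G (delta_mx k l)).

Lemma tensmap_tens m n p q (F : {linear 'M[C]_m -> 'M[C]_n})
    (G : {linear 'M[C]_p -> 'M[C]_q}) (A : 'M[C]_m) (B : 'M[C]_p) :
  tensmap F G (A *t B) = F A *t G B.
Proof.
have tE (a b c d : nat) (M : 'M[C]_(a, b)) (N : 'M[C]_(c, d)) r s :
    (M *t N) r s = M (mxtens_unindex r).1 (mxtens_unindex s).1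
                 * N (mxtens_unindex r).2 (mxtens_unindex s).2.
  by rewrite mxE.
apply/matrixP => r s; rewrite tE.
rewrite [in RHS](matrix_sum_delta A) [in RHS](matrix_sum_delta B).
rewrite /tensmap !linear_sum !summxE.
rewrite big_distrl /=; apply: eq_bigr => i _.
rewrite !linear_sum !summxE big_distrl /=; apply: eq_bigr => j _.
rewrite summxE big_distrr /=; apply: eq_bigr => k _.
rewrite linear_sum !summxE big_distrr /=; apply: eq_bigr => l _.
by rewrite !linearZ /= !mxE !mxtens_indexK /= mulrACA.
Qed.

Definition completely_positive n (F : 'M[C]_n -> 'M[C]_n) : Prop :=
  forall k (X : 'M[C]_(k * n)), psd X -> psd (tensmap (@id 'M[C]_k) F X).

Definition trace_preserving n (F : 'M[C]_n -> 'M[C]_n) : Prop :=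
  forall X, \tr (F X) = \tr X.

Definition unital_channel n (F : {linear 'M[C]_n -> 'M[C]_n}) : Prop :=
  [/\ completely_positive F, trace_preserving F & F 1%:M = 1%:M].

Definition local_unital_noise
    (U U' : R -> {linear 'M[C]_2 -> 'M[C]_2}) : Prop :=
  [/\ forall t, 0 <= t -> unital_channel (U t) /\ unital_channel (U' t),
      U 0 =1 id & U' 0 =1 id].

Definition mx2 (a b c d : C) : 'M[C]_2 :=
  \matrix_(i < 2, j < 2) nth 0 (nth [::] [:: [:: a; b]; [:: c; d]] i) j.

Definition pauli (k : 'I_4) : 'M[C]_2 :=
  [:: 1%:M; mx2 0 1 1 0; mx2 0 (- 'i) 'i 0; mx2 1 0 0 (-1)]`_k.

Definition pauli_rep (F : 'M[C]_2 -> 'M[C]_2) : 'M[C]_4 :=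
  \matrix_(i < 4, j < 4) (2^-1 * \tr (pauli i *m F (pauli j))).

Definition pauli_eigenbasis (k : 'I_4) (u v : 'cV[C]_2) : Prop :=
  [/\ cdot u u = 1, cdot v v = 1, cdot u v = 0,
      exists a, pauli k *m u = a *: u & exists b, pauli k *m v = b *: v].

End Operators.

Section Entanglement.
Variable R : realType.
Local Notation C := R[i].

Definition product_mixture (X : 'M[C]_(2 * 2)) : Prop :=
  exists (n : nat) (p : 'I_n -> R) (rA rB : 'I_n -> 'M[C]_2),
    [/\ forall k, 0 <= p k, \sum_k p k = 1,
        forall k, density (rA k), forall k, density (rB k)
      & X = \sum_k (p k)%:C *: (rA k *t rB k)].

(* The cast to [numFieldType] selects the norm topology on the matrices. *)
Definition separable (X : 'M[C]_(2 * 2)) : Prop :=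
  closure (product_mixture : set 'M[(C : numFieldType)]_(2 * 2)) X.

(* Extended-real valued: [+oo] when the output never becomes separable for
   good.  The infimum is the minimal time whenever a minimum exists; no
   continuity in [t] is assumed. *)
Definition entanglement_lifetime (Phi1 Phi2 : R -> 'M[C]_2 -> 'M[C]_2)
    (rho : 'M[C]_(2 * 2)) : \bar R :=
  ereal_inf [set tau%:E | tau in [set tau : R | 0 <= tau /\
    forall t, tau <= t -> separable (tensmap (Phi1 t) (Phi2 t) rho)]].

Definition max_lifetime (Phi1 Phi2 : R -> 'M[C]_2 -> 'M[C]_2) : \bar R :=
  ereal_sup [set entanglement_lifetime Phi1 Phi2 rho
            | rho in [set rho : 'M[C]_(2 * 2) | density rho]].

Definition ultimately_robust (Phi1 Phi2 : R -> 'M[C]_2 -> 'M[C]_2)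
    (rho : 'M[C]_(2 * 2)) : Prop :=
  density rho /\ entanglement_lifetime Phi1 Phi2 rho = max_lifetime Phi1 Phi2.

Definition max_entangled_ket (u u' v v' : 'cV[C]_2) : 'cV[C]_(2 * 2) :=
  (sqrtC 2)^-1 *: (u *t v + u' *t v').

End Entanglement.

(* Main.v *)
(* On correlation matrices [R a b = tr (rho sigma_a (x) sigma_b)], [a, b = 0..3],
   the noise acts as [R |-> D R D'] with [D = diag(1, lambda)] and
   [D' = diag(1, lambda')]. A pure state has [R = x y^T] with [x], [y] in the
   forward cone of Minkowski space (product states), or [R = k O] with [O] a
   Lorentz matrix. The claim is that once
   [sum_i |lambda_i lambda'_(p i)| <= 1] for every permutation [p] of the three
   Pauli indices, every [D O D'] is a sum of products [x y^T] of forward vectors.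
   Minimizing [tr (W K1 D O D' K2)] over Lorentz [K1, K2] (it is coercive because
   Lorentz matrices have trace at least [-2]) produces a diagonal normal form
   [X = K1 D O D' K2], and [X] is such a sum iff [sum_i |X_ii| <= X_00]. The
   latter is [0 <= tr (D O D' O')] for all Lorentz [O, O'], whose minimum is again
   attained at a diagonal [X = K1 D' K2]; there the equation [X^2 K1 = K1 D'^2]
   makes [|X_ii|] a permutation of [lambda'], so the minimum is at least
   [1 - sum_i lambda_i lambda'_(p i) >= 0].
   Conversely each of the six permutations [p] is witnessed by one maximally
   entangled state built from Pauli eigenvectors: its output can only be separable
   if the inequality for [p] holds. Hence whenever all six outputs are separable,
   every output is, and the longest lived of the six states maximizes the
   lifetime. *)
Require Import Defs.
From HB Require Import structures.
From mathcomp Require Import all_boot all_order all_algebra.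
From mathcomp Require Import all_classical all_reals all_analysis.
From mathcomp Require Import perm ring lra.
Set Implicit Arguments.
Unset Strict Implicit.
Unset Printing Implicit Defensive.
Import Order.TTheory GRing.Theory Num.Theory numFieldNormedType.Exports.
Local Open Scope ring_scope.

(** * Lorentz matrices and the forward cone *)

Section Lorentz.
Variable R : realFieldType.
Implicit Types (l m s : 'I_3 -> R) (K L M O X W : 'M[R]_4) (x y : 'cV[R]_4).

(** The Lorentz group is not compact, so a minimum is guaranteed only by strict contractions: each
    of the three diagonal factors then leaves a factor [1 - t], and the trace dominates
    [(1 - t)^3 * (K1 0 0 * K2 0 0)], which controls all entries of [K1] and [K2]. Moreover,
    stationarity forces [X] to be diagonal only when the weights are distinct, and matching the
    [X_ii] with the [lambda'] requires the latter to be distinct. The normal form is therefore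
    proved for injective coefficients in [(0, 1)].

    The general case follows by perturbation. Sign matrices are Lorentz, so signs can be split off;
    the absolute values are shrunk a little and then separated by small multiples of their ranks.
    The shrinking gives more room in the six inequalities than the ranks take away, and the closure
    in [separable] absorbs the error. *)

Definition dcoef l (a : 'I_4) : R := if unlift ord0 a is Some i then l i else 1.

(** It plays three roles: the action of a Pauli-diagonal unital channel on Bloch vectors, the
    Minkowski metric [G] when [l] is constantly [-1], and a Lorentz matrix when the [l i] are
    signs. *)
Definition bdiag l : 'M[R]_4 := diag_mx (\row_a dcoef l a).

Local Notation G := (bdiag (fun=> -1)).

(** Both determinants are allowed: this keeps all sign matrices, and entangled pure states do give
    determinant [-1], for instance [diag(1, 1, -1, 1)]. *)
Definition lorentz K := K^T *m G *m K = G /\ 0 < K 0 0.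

(** The closed forward light cone: the Bloch vectors of unnormalized qubit states, with the trace as
    time component. *)
Definition fcone x := 0 <= x 0 0 /\ \sum_i x (lift ord0 i) 0 ^+ 2 <= x 0 0 ^+ 2.

Lemma dcoef0 l : dcoef l 0 = 1.
Proof. by rewrite /dcoef unlift_none. Qed.

Lemma dcoefS l i : dcoef l (lift ord0 i) = l i.
Proof. by rewrite /dcoef liftK. Qed.

Lemma dcoefP (P : 'I_4 -> Prop) :
  P 0 -> (forall i : 'I_3, P (lift ord0 i)) -> forall a, P a.
Proof. by move=> P0 PS a; case: (unliftP ord0 a) => [i ->|->]. Qed.

Lemma mul_bdiag n l (A : 'M[R]_(4, n)) a b : (bdiag l *m A) a b = dcoef l a * A a b.
Proof. by rewrite mul_diag_mx !mxE. Qed.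

Lemma mul_mx_bdiag n l (A : 'M[R]_(n, 4)) a b : (A *m bdiag l) a b = A a b * dcoef l b.
Proof. by rewrite mul_mx_diag !mxE. Qed.

Lemma bdiagM l m : bdiag l *m bdiag m = bdiag (fun i => l i * m i).
Proof.
rewrite /bdiag mulmx_diag; congr diag_mx; apply/rowP=> a; rewrite !mxE.
by move: a; apply: dcoefP => [|i]; rewrite ?dcoef0 ?dcoefS ?mulr1.
Qed.

Lemma bdiag_tr l : (bdiag l)^T = bdiag l.
Proof. exact: tr_diag_mx. Qed.

Lemma bdiag1 l : (forall i, l i = 1) -> bdiag l = 1%:M.
Proof.
move=> l1; rewrite -diag_const_mx; congr diag_mx; apply/rowP=> a; rewrite !mxE.
by move: a; apply: dcoefP => [|i]; rewrite ?dcoef0 ?dcoefS.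
Qed.

Lemma bdiagC l m : bdiag l *m bdiag m = bdiag m *m bdiag l.
Proof. by rewrite /bdiag !mulmx_diag; congr diag_mx; apply/rowP=> a; rewrite !mxE mulrC. Qed.

Lemma bdiag_sqr1 s : (forall i, s i ^+ 2 = 1) -> bdiag s *m bdiag s = 1%:M.
Proof. by move=> s2; rewrite bdiagM bdiag1 // => i; rewrite -expr2. Qed.

Lemma metric2 : G *m G = 1%:M.
Proof. by apply: bdiag_sqr1 => i; rewrite sqrrN expr1n. Qed.

Lemma bdiag_lorentz s : (forall i, s i ^+ 2 = 1) -> lorentz (bdiag s).
Proof.
move=> s2; split; last by rewrite !mxE eqxx dcoef0 ltr01.
by rewrite bdiag_tr bdiagC -mulmxA bdiag_sqr1 // mulmx1.
Qed.

Definition minkowski x y := x 0 0 * y 0 0 - \sum_i x (lift ord0 i) 0 * y (lift ord0 i) 0.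

Lemma minkowskiE x y : x^T *m G *m y = (minkowski x y)%:M.
Proof.
apply/matrixP => i j; rewrite !ord1 mxE big_ord_recl mul_mx_bdiag dcoef0 !mxE mulr1n.
rewrite mulr1 /minkowski -sumrN; congr (_ + _); apply: eq_bigr => k _.
by rewrite mul_mx_bdiag dcoefS mxE mulrN1 mulNr.
Qed.

Lemma lorentz_inv K : lorentz K -> (G *m K^T *m G) *m K = 1%:M.
Proof. by case=> KG _; rewrite -!mulmxA (mulmxA K^T) KG metric2. Qed.

Lemma lorentz_invr K : lorentz K -> K *m (G *m K^T *m G) = 1%:M.
Proof. by move=> /lorentz_inv/mulmx1C. Qed.

Lemma lorentz_tr K : lorentz K -> lorentz K^T.
Proof.
move=> hK; split; last by rewrite mxE; case: hK.
rewrite trmxK; have := lorentz_invr hK; rewrite !mulmxA => e.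
by rewrite -[LHS]mulmx1 -metric2 !mulmxA e mul1mx.
Qed.

Lemma lorentz_minkowski K x y : lorentz K -> minkowski (K *m x) (K *m y) = minkowski x y.
Proof.
move=> [hK _]; have : (minkowski (K *m x) (K *m y))%:M = (minkowski x y)%:M :> 'M[R]_1.
  by rewrite -!minkowskiE trmx_mul -[in RHS]hK !mulmxA.
by move=> /matrixP/(_ 0 0); rewrite !mxE eqxx !mulr1n.
Qed.

Lemma sum3 (F : 'I_3 -> R) : \sum_i F i = F 0 + F 1 + F (lift 0 (lift 0 0)).
Proof. by rewrite !big_ord_recl big_ord0 addr0 addrA; congr (_ + F _ + F _); apply/val_inj. Qed.

Lemma sum4 (F : 'I_4 -> R) : \sum_a F a = F 0 + \sum_i F (lift ord0 i).
Proof. by rewrite big_ord_recl. Qed.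

Lemma cauchy3 (u v : 'I_3 -> R) :
  (\sum_i u i * v i) ^+ 2 <= (\sum_i u i ^+ 2) * (\sum_i v i ^+ 2).
Proof.
rewrite !sum3; set a := u 0; set b := u 1; set c := u _.
set d := v 0; set e := v 1; set f := v _.
rewrite -subr_ge0.
have -> : (a ^+ 2 + b ^+ 2 + c ^+ 2) * (d ^+ 2 + e ^+ 2 + f ^+ 2) - (a * d + b * e + c * f) ^+ 2
  = (a * e - b * d) ^+ 2 + (a * f - c * d) ^+ 2 + (b * f - c * e) ^+ 2 by ring.
by rewrite !addr_ge0 ?sqr_ge0.
Qed.

Lemma ler_norm_sqr (a b : R) : 0 <= b -> a ^+ 2 <= b ^+ 2 -> `|a| <= b.
Proof. by move=> b0 ab; rewrite -(@ler_pXn2r _ 2) ?nnegrE // real_normK ?num_real. Qed.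

Lemma cauchy_le (u v : 'I_3 -> R) a b : 0 <= a -> 0 <= b ->
  \sum_i u i ^+ 2 <= a ^+ 2 -> \sum_i v i ^+ 2 <= b ^+ 2 ->
  `|\sum_i u i * v i| <= a * b.
Proof.
move=> a0 b0 ua vb; apply: ler_norm_sqr; first exact: mulr_ge0.
rewrite exprMn (le_trans (cauchy3 _ _)) // ler_pM // sumr_ge0 // => i _; exact: sqr_ge0.
Qed.

Lemma fconeE x : fcone x <-> 0 <= x 0 0 /\ 0 <= minkowski x x.
Proof.
by rewrite /fcone /minkowski subr_ge0.
Qed.

Lemma fcone_dot x y : fcone x -> fcone y ->
  `|\sum_i x (lift ord0 i) 0 * y (lift ord0 i) 0| <= x 0 0 * y 0 0.
Proof. by move=> [x0 hx] [y0 hy]; exact: cauchy_le. Qed.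

Lemma fcone_dot_ge0 x y : fcone x -> fcone y -> 0 <= \sum_a x a 0 * y a 0.
Proof.
move=> hx hy; rewrite sum4; have := fcone_dot hx hy.
by rewrite ler_norml => /andP[+ _]; rewrite -subr_ge0 opprK addrC.
Qed.

Lemma lorentz_col0 K : lorentz K -> 1 + \sum_i K (lift ord0 i) 0 ^+ 2 = K 0 0 ^+ 2.
Proof.
case=> /matrixP/(_ 0 0) + _; rewrite mxE sum4 mul_mx_bdiag dcoef0 !mxE eqxx mulr1n dcoef0 mulr1.
under eq_bigr do rewrite mul_mx_bdiag dcoefS mxE mulrN1 mulNr -expr2.
by rewrite sumrN -expr2 => <-; rewrite subrK.
Qed.

Lemma lorentz_row0 K : lorentz K -> 1 + \sum_i K 0 (lift ord0 i) ^+ 2 = K 0 0 ^+ 2.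
Proof. by move=> /lorentz_tr/lorentz_col0; rewrite mxE; under eq_bigr do rewrite mxE. Qed.

Lemma lorentz_col K a b : lorentz K ->
  K 0 a * K 0 b - \sum_i K (lift ord0 i) a * K (lift ord0 i) b = (G a b).
Proof.
case=> /matrixP/(_ a b) + _; rewrite mxE sum4 mul_mx_bdiag dcoef0 mxE mulr1.
under eq_bigr do rewrite mul_mx_bdiag dcoefS mxE mulrN1 mulNr.
by rewrite sumrN => <-.
Qed.

Lemma lorentz_row K a b : lorentz K ->
  K a 0 * K b 0 - \sum_i K a (lift ord0 i) * K b (lift ord0 i) = (G a b).
Proof.
by move=> /lorentz_tr/lorentz_col-/(_ a b); rewrite !mxE; under eq_bigr do rewrite !mxE.
Qed.

Lemma lorentz00_ge1 K : lorentz K -> 1 <= K 0 0.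
Proof.
move=> hK; have := lorentz_col0 hK; case: hK => _ K0 e.
rewrite -(@ler_pXn2r _ 2) ?nnegrE ?ler01 ?(ltW K0) // expr1n -e lerDl.
by apply: sumr_ge0 => i _; exact: sqr_ge0.
Qed.

(** The Minkowski square is invariant. The time component stays nonnegative because it is the
    Euclidean product of [x] with row 0 of [K], itself a forward vector. *)
Lemma fcone_lorentz K x : lorentz K -> fcone x -> fcone (K *m x).
Proof.
move=> hK hx; apply/fconeE; split; last by rewrite lorentz_minkowski //; case/fconeE: hx.
have rK : fcone (row 0 K)^T.
  split; first by rewrite !mxE; case: hK => _ /ltW.
  under eq_bigr do rewrite !mxE.
  by rewrite !mxE -(lorentz_row0 hK) lerDr ler01.
have := fcone_dot_ge0 rK hx; rewrite mxE.
by under eq_bigr do rewrite !mxE.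
Qed.

Lemma e0_fcone : fcone (delta_mx 0 0).
Proof.
split; rewrite !mxE /= ?ler01 // expr1n big1 ?ler01 // => i _; by rewrite !mxE /= expr0n.
Qed.

Lemma col0_fcone K : lorentz K -> fcone (col 0 K).
Proof. by move=> hK; rewrite colE; apply: fcone_lorentz => //; apply: e0_fcone. Qed.

Lemma lorentzM K L : lorentz K -> lorentz L -> lorentz (K *m L).
Proof.
move=> hK hL; split.
  by case: hK hL => eK _ [eL _]; rewrite trmx_mul !mulmxA -(mulmxA L^T) -(mulmxA L^T) eK eL.
have h := fcone_lorentz hK (col0_fcone hL).
have e : K *m col 0 L = col 0 (K *m L) by rewrite !colE mulmxA.
have : 1 + \sum_i (K *m L) (lift ord0 i) 0 ^+ 2 = (K *m L) 0 0 ^+ 2.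
  have := lorentz_minkowski (col 0 L) (col 0 L) hK; rewrite e /minkowski.
  have cE (M : 'M[R]_4) a : (col 0 M) a 0 = M a 0 by rewrite mxE.
  under eq_bigr do rewrite cE -expr2; rewrite cE -expr2.
  under [in RHS]eq_bigr do rewrite cE -expr2; rewrite cE -expr2.
  by rewrite -(lorentz_col0 hL) addrK => /eqP; rewrite subr_eq => /eqP.
(* A vanishing time component would contradict the identity just proved, whose left side is at least
   1. *)
rewrite e in h; case: h; rewrite mxE le_eqVlt => /orP[/eqP <-|//] _ /eqP.
rewrite expr0n /= gt_eqF // ltr_wpDr // ?ltr01 // sumr_ge0 // => i _; exact: sqr_ge0.
Qed.

Lemma lorentz1 : lorentz 1%:M.
Proof. by rewrite -(@bdiag1 (fun=> 1)) //; apply: bdiag_lorentz => i; rewrite expr1n. Qed.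

Lemma lorentzV K : lorentz K -> exists2 L, lorentz L & K *m L = 1%:M /\ L *m K = 1%:M.
Proof.
move=> hK; exists (G *m K^T *m G); last by split; [apply: lorentz_invr | apply: lorentz_inv].
by apply: lorentzM; [apply: lorentzM; last exact: lorentz_tr|];
   apply: bdiag_lorentz => i; rewrite sqrrN expr1n.
Qed.

(** Bounding the single entry [K 0 0] thus bounds the whole matrix, which is the source of
    compactness in [lorentz_minimum]. *)
Lemma lorentz_entry K a b : lorentz K -> `|K a b| <= K 0 0.
Proof.
move=> hK; have K1 := lorentz00_ge1 hK; have K0 := le_trans ler01 K1.
have c0 c : `|K c 0| <= K 0 0.
  apply: (@dcoefP (fun c => `|K c 0| <= K 0 0)) => [|i]; first by rewrite ger0_norm.
  apply: ler_norm_sqr => //; rewrite -(lorentz_col0 hK) (bigD1 i) //= addrCA lerDl.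
  by rewrite addr_ge0 ?ler01 // sumr_ge0 // => j _; exact: sqr_ge0.
move: b; apply: (@dcoefP (fun b => `|K a b| <= K 0 0)) => // j.
move: a; apply: (@dcoefP (fun a => `|K a _| <= K 0 0)) => [|i].
  apply: ler_norm_sqr => //; rewrite -(lorentz_row0 hK) (bigD1 j) //= addrCA lerDl.
  by rewrite addr_ge0 ?ler01 // sumr_ge0 // => k _; exact: sqr_ge0.
apply: ler_norm_sqr => //.
have := lorentz_row (lift ord0 i) (lift ord0 i) hK; rewrite !mxE eqxx mulr1n dcoefS -expr2.
under eq_bigr do rewrite -expr2.
move=> /eqP; rewrite subr_eq -(lorentz_col0 hK) => /eqP e.
have : K (lift ord0 i) (lift ord0 j) ^+ 2 <= \sum_k K (lift ord0 i) (lift ord0 k) ^+ 2.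
  by rewrite (bigD1 j) //= lerDl sumr_ge0 // => k _; exact: sqr_ge0.
have : K (lift ord0 i) 0 ^+ 2 <= \sum_k K (lift ord0 k) 0 ^+ 2.
  by rewrite (bigD1 i) //= lerDl sumr_ge0 // => k _; exact: sqr_ge0.
lra.
Qed.

(* The polar decomposition: the spatial block is an orthogonal matrix plus the
   rank-one boost part [a b^T / (K 0 0 + 1)], [a] and [b] being the spatial
   parts of the first column and row. *)
Lemma lorentz_trace K : lorentz K -> \sum_i `|K (lift ord0 i) (lift ord0 i)| <= K 0 0 + 2.
Proof.
move=> hK; have K1 := lorentz00_ge1 hK; set g := K 0 0 in K1 *.
have g1 : g + 1 != 0 by rewrite gt_eqF //; lra.
pose a i := K (lift ord0 i) 0; pose b i := K 0 (lift ord0 i).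
have ha : \sum_i a i ^+ 2 = g ^+ 2 - 1 by rewrite -(lorentz_col0 hK) addrAC subrr add0r.
have hb : \sum_i b i ^+ 2 = g ^+ 2 - 1 by rewrite -(lorentz_row0 hK) addrAC subrr add0r.
pose O i j := K (lift ord0 i) (lift ord0 j) - a i * b j / (g + 1).
have O1 i : \sum_j O i j ^+ 2 = 1.
  have e1 : \sum_j K (lift ord0 i) (lift ord0 j) * b j = a i * g.
    have := lorentz_row (lift ord0 i) 0 hK; rewrite !mxE /= mulr0n.
    by move=> /eqP; rewrite subr_eq0 => /eqP.
  have e2 : \sum_j K (lift ord0 i) (lift ord0 j) ^+ 2 = 1 + a i ^+ 2.
    have := lorentz_row (lift ord0 i) (lift ord0 i) hK; rewrite !mxE eqxx mulr1n dcoefS -expr2.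
    under eq_bigr do rewrite -expr2.
    by rewrite -/(a i) => e; lra.
  have -> : \sum_j O i j ^+ 2 = \sum_j K (lift ord0 i) (lift ord0 j) ^+ 2
     - (2 * a i / (g + 1)) * (\sum_j K (lift ord0 i) (lift ord0 j) * b j)
     + (a i / (g + 1)) ^+ 2 * \sum_j b j ^+ 2.
    rewrite !mulr_sumr -sumrB -big_split /=; apply: eq_bigr => j _.
    by rewrite /O; field.
  by rewrite e1 e2 hb; field.
have Oii i : `|O i i| <= 1.
  apply: ler_norm_sqr => //; rewrite expr1n -(O1 i) (bigD1 i) //= lerDl.
  by rewrite sumr_ge0 // => k _; exact: sqr_ge0.
have ab i : `|a i * b i| <= (a i ^+ 2 + b i ^+ 2) / 2.
  rewrite ler_norml; have := sqr_ge0 (a i - b i); have := sqr_ge0 (a i + b i).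
  by rewrite sqrrD sqrrB => h1 h2; apply/andP; split; lra.
(* The orthogonal part contributes at most 3 and the boost part at most [g - 1]. *)
have : \sum_i `|K (lift ord0 i) (lift ord0 i)| <= \sum_i (1 + (a i ^+ 2 + b i ^+ 2) / (2 * (g + 1))).
  apply: ler_sum => i _.
  have -> : K (lift ord0 i) (lift ord0 i) = O i i + a i * b i / (g + 1) by rewrite /O subrK.
  rewrite (le_trans (ler_normD _ _)) // lerD //.
  rewrite invfM mulrA normrM normfV (ger0_norm (_ : 0 <= g + 1)); last by lra.
  by rewrite ler_wpM2r // invr_ge0; lra.
rewrite big_split /= -mulr_suml big_split /= ha hb sumr_const card_ord => /le_trans; apply.
have -> : (g ^+ 2 - 1 + (g ^+ 2 - 1)) / (2 * (g + 1)) = g - 1 by field.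
by lra.
Qed.

End Lorentz.

(** * Minimizing over pairs of Lorentz matrices *)

Section Minimum.
Variable R : realType.
Implicit Types (l m s w : 'I_3 -> R) (K L M O X W : 'M[R]_4) (x y : 'cV[R]_4).
Local Notation G := (bdiag (fun=> -1)).

Lemma trace_bdiag l (A : 'M[R]_4) :
  \tr (bdiag l *m A) = A 0 0 + \sum_i l i * A (lift ord0 i) (lift ord0 i).
Proof.
rewrite /mxtrace sum4 mul_bdiag dcoef0 mul1r; congr (_ + _).
by apply: eq_bigr => i _; rewrite mul_bdiag dcoefS.
Qed.

(** The trace is affine in [l], so over the cube it is smallest at a vertex: the signs opposite to
    the diagonal of [A]. *)
Lemma trace_bdiag_vertex (A : 'M[R]_4) c l :
  (forall s, (forall i, s i ^+ 2 = 1) -> c <= \tr (bdiag s *m A)) ->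
  (forall i, `|l i| <= 1) -> c <= \tr (bdiag l *m A).
Proof.
move=> hA hl; pose s i : R := if 0 <= A (lift ord0 i) (lift ord0 i) then -1 else 1.
have s2 i : s i ^+ 2 = 1 by rewrite /s; case: ifP; rewrite ?sqrrN expr1n.
apply: (le_trans (hA _ s2)); rewrite !trace_bdiag lerD2l; apply: ler_sum => i _.
have := hl i; rewrite ler_norml => /andP[h1 h2]; rewrite /s; case: ifP => h.
  by rewrite ler_wpM2r.
by rewrite ler_wnM2r // ltW // ltNge h.
Qed.

Lemma lorentz_trace_ge K : lorentz K -> -2 <= \tr K.
Proof.
move=> /lorentz_trace hK; rewrite /mxtrace sum4.
have : - \sum_i `|K (lift ord0 i) (lift ord0 i)| <= \sum_i K (lift ord0 i) (lift ord0 i).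
  by rewrite -sumrN; apply: ler_sum => i _; rewrite lerNl -normrN ler_norm.
set a := \sum_i `|_| in hK *; set b := \sum_i _; lra.
Qed.

(** Cyclicity brings each of the three diagonal factors to the front in turn, where it may be
    replaced by signs. What remains is the trace of a product of Lorentz matrices. *)
Lemma trace_contraction_ge w l m O K1 K2 : lorentz O -> lorentz K1 -> lorentz K2 ->
  (forall i, `|w i| <= 1) -> (forall i, `|l i| <= 1) -> (forall i, `|m i| <= 1) ->
  -2 <= \tr (bdiag w *m (K1 *m (bdiag l *m O *m bdiag m) *m K2)).
Proof.
move=> hO h1 h2 hw hl hm; apply: trace_bdiag_vertex hw => s hs.
have -> : \tr (bdiag s *m (K1 *m (bdiag l *m O *m bdiag m) *m K2))
    = \tr (bdiag l *m (O *m bdiag m *m (K2 *m bdiag s *m K1))).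
  by rewrite [RHS]mxtrace_mulC -!mulmxA; do 5! [rewrite mxtrace_mulC -!mulmxA].
apply: trace_bdiag_vertex hl => s' hs'.
have -> : \tr (bdiag s' *m (O *m bdiag m *m (K2 *m bdiag s *m K1)))
    = \tr (bdiag m *m (K2 *m bdiag s *m K1 *m bdiag s' *m O)).
  by do 4! [rewrite [RHS]mxtrace_mulC -!mulmxA].
apply: trace_bdiag_vertex hm => s'' hs''; apply: lorentz_trace_ge.
by do ![apply: lorentzM | apply: bdiag_lorentz].
Qed.

Lemma fcone_bdiag l x : (forall i, `|l i| <= 1) -> fcone x -> fcone (bdiag l *m x).
Proof.
move=> hl [x0 hx]; split; rewrite mul_bdiag dcoef0 mul1r //; apply: le_trans hx.
apply: ler_sum => i _; rewrite mul_bdiag dcoefS exprMn ler_piMl ?sqr_ge0 //.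
by rewrite -real_normK ?num_real // expr_le1.
Qed.

(** By Cauchy-Schwarz the contracted spatial part consumes at most the fraction [t] of the time
    part. *)
Lemma fcone_bdiag_dot t l x y : 0 <= t -> (forall i, `|l i| <= t) -> fcone x -> fcone y ->
  (1 - t) * (x 0 0 * y 0 0) <= (x^T *m bdiag l *m y) 0 0.
Proof.
move=> t0 hl [x0 hx] [y0 hy]; rewrite mxE sum4 mul_mx_bdiag dcoef0 mulr1 mxE.
rewrite mulrBl mul1r lerD2l.
under eq_bigr do rewrite mul_mx_bdiag dcoefS mxE.
suff : `|\sum_i x (lift ord0 i) 0 * l i * y (lift ord0 i) 0| <= t * x 0 0 * y 0 0.
  by rewrite ler_norml mulrA => /andP[].
apply: cauchy_le => //; first exact: mulr_ge0.
rewrite exprMn mulrC; apply: le_trans (ler_wpM2r (sqr_ge0 t) hx).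
rewrite mulr_suml; apply: ler_sum => i _; rewrite exprMn ler_wpM2l ?sqr_ge0 //.
by rewrite -(real_normK (num_real (l i))) ler_pXn2r ?nnegrE.
Qed.

(** One factor [1 - t] comes from [w], and one from each of [l] and [m] through [fcone_bdiag_dot];
    [O 0 0 >= 1] closes the estimate. *)
Lemma trace_coercive t w l m O K1 K2 : 0 < t < 1 -> lorentz O -> lorentz K1 -> lorentz K2 ->
  (forall i, `|w i| <= t) -> (forall i, `|l i| <= t) -> (forall i, `|m i| <= t) ->
  (1 - t) ^+ 3 * (K1 0 0 * K2 0 0) - 2
    <= \tr (bdiag w *m (K1 *m (bdiag l *m O *m bdiag m) *m K2)).
Proof.
move=> /andP[t0 t1] hO h1 h2 hw hl hm.
have le1 (f : 'I_3 -> R) : (forall i, `|f i| <= t) -> forall i, `|f i| <= 1.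
  by move=> hf i; apply: le_trans (hf i) (ltW t1).
set Y := K1 *m _ *m _; pose w' i := w i / t.
(* [bdiag w] is the convex combination, with weights [1 - t] and [t], of the projection onto the
   time axis and of the still contracting [bdiag w']. *)
have -> : \tr (bdiag w *m Y) = (1 - t) * Y 0 0 + t * \tr (bdiag w' *m Y).
  rewrite !trace_bdiag mulrDr addrA -mulrDl subrK mul1r mulr_sumr; congr (_ + _).
  by apply: eq_bigr => i _; rewrite /w'; field; rewrite gt_eqF.
have h3 : -2 <= \tr (bdiag w' *m Y).
  apply: trace_contraction_ge => //; try exact: le1.
  by move=> i; rewrite normrM normfV (gtr0_norm t0) ler_pdivrMr // mul1r.
have Y0 : (1 - t) ^+ 2 * (K1 0 0 * K2 0 0) <= Y 0 0.
  have hv : fcone (O *m (bdiag m *m col 0 K2)).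
    apply: fcone_lorentz => //; apply: fcone_bdiag; first exact: le1.
    exact: col0_fcone.
  have ent n (C : 'M[R]_4) (v : 'M[R]_(4, n.+1)) : (C *m v) 0 0 = ((col 0 C^T)^T *m col 0 v) 0 0.
    by rewrite !mxE; apply: eq_bigr => k _; rewrite !mxE.
  have e1 : Y 0 0 = ((col 0 K1^T)^T *m bdiag l *m (O *m (bdiag m *m col 0 K2))) 0 0.
    by rewrite /Y -!mulmxA ent !colE !mulmxA.
  have e2 : (O *m (bdiag m *m col 0 K2)) 0 0 = ((col 0 O^T)^T *m bdiag m *m col 0 K2) 0 0.
    rewrite ent -mulmxA; congr ((_ *m _) 0 0).
    by apply/colP => k; rewrite mxE.
  have b1 := fcone_bdiag_dot (ltW t0) hl (col0_fcone (lorentz_tr h1)) hv.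
  have b2 := fcone_bdiag_dot (ltW t0) hm (col0_fcone (lorentz_tr hO)) (col0_fcone h2).
  rewrite -e1 in b1; rewrite -e2 in b2; apply: le_trans b1; move: b2.
  rewrite !(mxE, ord1) /= => b2.
  have cE (A : 'M[R]_4) : col 0 A^T 0 0 = A 0 0 by rewrite !mxE.
  have K10 := lorentz00_ge1 h1; have K20 := lorentz00_ge1 h2; have O0 := lorentz00_ge1 hO.
  rewrite expr2 -mulrA ler_wpM2l ?subr_ge0 ?(ltW t1) // mulrCA ler_wpM2l //; first lra.
  apply: le_trans b2; rewrite ler_wpM2l ?subr_ge0 ?(ltW t1) // ler_peMl //; lra.
have : (1 - t) * ((1 - t) ^+ 2 * (K1 0 0 * K2 0 0)) <= (1 - t) * Y 0 0.
  by rewrite ler_wpM2l // subr_ge0 ltW.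
rewrite mulrA -exprS; set u := _ ^+ 3 * _; set v := (1 - t) * _; set z := \tr _ in h3 *.
have : t * (-2) <= t * z by rewrite ler_wpM2l // ltW.
lra.
Qed.

Lemma continuous_sumr (T : topologicalType) (I : finType) (F : I -> T -> R) :
  (forall i, continuous (F i)) -> continuous (fun v => \sum_i F i v).
Proof.
move=> hF; elim: (index_enum I) => [|i r IH] v.
  by under eq_fun do rewrite big_nil; exact: cvg_cst.
by under eq_fun do rewrite big_cons; apply: cvgD; [exact: hF | exact: IH].
Qed.

Lemma continuous_mulmx (T : topologicalType) n p q (A : T -> 'M[R]_(n, p)) (B : T -> 'M[R]_(p, q)) :
  (forall i j, continuous (fun v => A v i j)) -> (forall i j, continuous (fun v => B v i j)) ->
  forall i j, continuous (fun v => (A v *m B v) i j).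
Proof.
move=> hA hB i j; under eq_fun do rewrite mxE.
by apply: continuous_sumr => k v; apply: cvgM; [exact: hA | exact: hB].
Qed.

(** The sublevel set of the value at the identity pair is compact: coercivity bounds the product
    [K1 0 0 * K2 0 0], hence both factors, as each is at least 1. A pair of matrices is flattened
    into one row vector of length 32, so that compactness of boxes applies; continuity is assumed
    along arbitrary families so that it composes with this flattening. *)
Lemma lorentz_minimum (f : 'M[R]_4 -> 'M[R]_4 -> R) c : 0 < c ->
  (forall (T : topologicalType) (A B : T -> 'M[R]_4),
     (forall i j, continuous (fun v => A v i j)) ->
     (forall i j, continuous (fun v => B v i j)) -> continuous (fun v => f (A v) (B v))) ->
  (forall K1 K2, lorentz K1 -> lorentz K2 -> c * (K1 0 0 * K2 0 0) - 2 <= f K1 K2) ->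
  exists K1 K2, [/\ lorentz K1, lorentz K2
    & forall L1 L2, lorentz L1 -> lorentz L2 -> f K1 K2 <= f L1 L2].
Proof.
move=> c0 fc coer.
pose n := (4 * 4 + 4 * 4)%N.
pose A (v : 'rV[R]_n) : 'M[R]_4 := vec_mx (lsubmx v).
pose B (v : 'rV[R]_n) : 'M[R]_4 := vec_mx (rsubmx v).
have cA i j : continuous (fun v => A v i j).
  have -> : (fun v => A v i j) = (fun v : 'rV_n => v 0 (lshift _ (mxvec_index i j))).
    by apply/funext => v; rewrite !mxE.
  exact: coord_continuous.
have cB i j : continuous (fun v => B v i j).
  have -> : (fun v => B v i j) = (fun v : 'rV_n => v 0 (rshift _ (mxvec_index i j))).
    by apply/funext => v; rewrite !mxE.
  exact: coord_continuous.
pose b := (f 1%:M 1%:M + 2) / c.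
have b_ge K1 K2 : lorentz K1 -> lorentz K2 -> f K1 K2 <= f 1%:M 1%:M ->
    K1 0 0 <= b /\ K2 0 0 <= b.
  move=> h1 h2 le; have := coer _ _ h1 h2; have g1 := lorentz00_ge1 h1.
  have g2 := lorentz00_ge1 h2 => h.
  have h3 : K1 0 0 * K2 0 0 <= b by rewrite /b ler_pdivlMr // mulrC; lra.
  by split; apply: le_trans h3; rewrite ?ler_peMr ?ler_peMl //; lra.
(* The open condition [0 < C v 0 0] is replaced by [1 <= C v 0 0], which is closed and equivalent
   for Lorentz matrices. *)
pose lset (C : 'rV[R]_n -> 'M[R]_4) := [set v | ((C v)^T *m G *m C v)%R = G /\ (1 <= C v 0 0 <= b)%R]%classic.
have lclosed (C : 'rV[R]_n -> 'M[R]_4) : (forall i j, continuous (fun v => C v i j)) -> closed (lset C).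
  move=> cC.
  have -> : lset C = (\bigcap_(ij in [set: 'I_4 * 'I_4]%classic) 
      [set v | ((C v)^T *m G *m C v)%R ij.1 ij.2 = G ij.1 ij.2]
      `&` [set v | (1 <= C v 0 0)%R] `&` [set v | (C v 0 0 <= b)%R])%classic.
    apply/seteqP; split => v /=.
      by move=> [e /andP[h1 h2]]; split => //; split => // ij _ /=; rewrite e.
    move=> [[h h1] h2]; rewrite /lset /= h1 h2; split=> //.
    by apply/matrixP => i j; apply: (h (i, j)).
  apply: closedI; last first.
    by apply: (preimage_closed _ (@closed_le _ _)) => v _; apply: cC.
  apply: closedI; last first.
    by apply: (preimage_closed _ (@closed_ge _ _)) => v _; apply: cC.
  apply: closed_bigI => ij _.
  apply: (preimage_closed _ (@closed_eq _ (G ij.1 ij.2))) => v _.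
  apply: continuous_mulmx => // i j; apply: continuous_mulmx => i' j'.
    under eq_fun do rewrite mxE.
    exact: cC.
  exact: cst_continuous.
have lP C v : lset C v -> lorentz (C v).
  by move=> [e /andP[h _]]; split=> //; apply: lt_le_trans ltr01 h.
pose S := (lset A `&` lset B)%classic.
have compS : compact S.
  have box : compact [set v : 'rV[R]_n | forall i, v ord0 i \in `[(- b), b]].
    apply: (@rV_compact _  _ (fun=> `[(- b), b]%classic)).
    by move=> _; apply: segment_compact.
  apply: subclosed_compact box _; first by apply: closedI; apply: lclosed.
  move=> v [vA vB] k; rewrite in_itv /= -ler_norml.
  case: (split_ordP k) => {}k ->; case: (mxvec_indexP k) => i j.
    have -> : v ord0 (lshift _ (mxvec_index i j)) = A v i j by rewrite !mxE.
    by rewrite (le_trans (lorentz_entry _ _ (lP _ _ vA))) //; case: vA => _ /andP[].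
  have -> : v ord0 (rshift _ (mxvec_index i j)) = B v i j by rewrite !mxE.
  by rewrite (le_trans (lorentz_entry _ _ (lP _ _ vB))) //; case: vB => _ /andP[].
have AB K1 K2 : A (row_mx (mxvec K1) (mxvec K2)) = K1 /\ B (row_mx (mxvec K1) (mxvec K2)) = K2.
  by rewrite /A /B row_mxKl row_mxKr !mxvecK.
have inS K1 K2 : lorentz K1 -> lorentz K2 -> f K1 K2 <= f 1%:M 1%:M ->
    S (row_mx (mxvec K1) (mxvec K2)).
  move=> h1 h2 le; have [b1 b2] := b_ge _ _ h1 h2 le; have [eA eB] := AB K1 K2.
  split; rewrite /lset /= ?eA ?eB.
    by split; [case: h1 | rewrite lorentz00_ge1].
  by split; [case: h2 | rewrite lorentz00_ge1].
have S0 : (S !=set0)%classic.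
  by exists (row_mx (mxvec 1%:M) (mxvec 1%:M)); apply: inS; rewrite ?lexx //; exact: lorentz1.
have fcont : continuous (fun v => f (A v) (B v)) by exact: fc.
have [v] := compact_EVT_min S0 compS (continuous_subspaceT fcont).
rewrite inE => -[vA vB] vmin; exists (A v), (B v); split; [exact: lP..|].
have h1 : f (A v) (B v) <= f 1%:M 1%:M.
  have := vmin (row_mx (mxvec 1%:M) (mxvec 1%:M)).
  have [-> ->] := AB 1%:M 1%:M; apply; rewrite inE; apply: inS => //; exact: lorentz1.
move=> L1 L2 hL1 hL2; case: (leP (f L1 L2) (f 1%:M 1%:M)) => [le|/ltW]; last exact: le_trans.
have := vmin (row_mx (mxvec L1) (mxvec L2)).
by have [-> ->] := AB L1 L2; apply; rewrite inE; apply: inS.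
Qed.

End Minimum.

(** * Diagonal normal form *)

Section NormalForm.
Variable R : realType.
Implicit Types (l m s w : 'I_3 -> R) (K L M O X W : 'M[R]_4) (x y : 'cV[R]_4).
Local Notation G := (bdiag (fun=> -1)).

(* Rational parametrization of the conic [c^2 + g r^2 = 1] near [c = 1]: the
   linear term of an expression minimal at [(1, 0)] vanishes. *)
Lemma conic_stationary (g a b : R) : g ^+ 2 = 1 ->
  (forall c r : R, 0 < c -> c ^+ 2 + g * r ^+ 2 = 1 -> 0 <= (c - 1) * a + r * b) -> b = 0.
Proof.
move=> g2 h; apply/eqP/negPn/negP => b0.
(* The parameter [t] has the sign opposite to [b], and [k] makes it small enough for the term linear
   in [t] to dominate the quadratic one. *)
pose k := (1 + `|a| + `|b|)^-1; pose t := - k * b.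
have a0 := normr_ge0 a; have nb0 := normr_ge0 b.
have k0 : 0 < k by rewrite invr_gt0; lra.
have kE : k * (1 + `|a| + `|b|) = 1 by rewrite mulVf // gt_eqF; lra.
have g1 : `|g| = 1 by apply/eqP; rewrite -(@eqrXn2 _ 2) ?normr_ge0 ?ler01 // real_normK ?num_real // g2 expr1n.
have ka : `|g * k * a| < 1.
  rewrite 2!normrM g1 mul1r gtr0_norm // -[ltRHS]kE ltr_pM2l //.
  have : 0 < `|b| by rewrite normr_gt0.
  lra.
have tb : `|t| < 1.
  by rewrite /t mulNr normrN normrM gtr0_norm // -[ltRHS]kE ltr_pM2l //; lra.
have t2 : t ^+ 2 < 1 by rewrite -real_normK ?num_real // expr_lt1.
have gt2 : `|g * t ^+ 2| < 1 by rewrite normrM g1 mul1r ger0_norm ?sqr_ge0.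
have /andP[p1 p2] : (0 < 1 + g * t ^+ 2) && (0 < 1 - g * t ^+ 2).
  move: gt2; rewrite ltr_norml; set u := g * _ => /andP[h1 h2]; apply/andP; split; lra.
have n0 : 1 + g * t ^+ 2 != 0 by rewrite gt_eqF.
have /= := h ((1 - g * t ^+ 2) / (1 + g * t ^+ 2)) (2 * t / (1 + g * t ^+ 2)).
have -> : ((1 - g * t ^+ 2) / (1 + g * t ^+ 2)) ^+ 2 + g * (2 * t / (1 + g * t ^+ 2)) ^+ 2 = 1 by field.
rewrite divr_gt0 // => /(_ isT erefl).
have -> : ((1 - g * t ^+ 2) / (1 + g * t ^+ 2) - 1) * a + 2 * t / (1 + g * t ^+ 2) * b
    = 2 * (- (k * b ^+ 2 * (1 + g * k * a))) / (1 + g * t ^+ 2).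
  by move: n0; rewrite /t => n0; field.
rewrite pmulr_lge0 ?invr_gt0 // pmulr_rge0 // oppr_ge0 leNgt => /negP; apply.
apply: mulr_gt0; first by apply: mulr_gt0 => //; rewrite exprn_even_gt0.
by move: ka; rewrite ltr_norml; set u := g * k * a => /andP[h1 h2]; lra.
Qed.

Definition gsign (a b : 'I_4) : R := dcoef (fun=> -1) a * dcoef (fun=> -1) b.

(* A rotation ([gsign a b = 1]) or a boost ([gsign a b = -1]) in the plane [(a, b)]. *)
Definition planar (a b : 'I_4) (c r : R) : 'M[R]_4 :=
  1%:M + (c - 1) *: (delta_mx a a + delta_mx b b)
    + r *: (delta_mx a b - gsign a b *: delta_mx b a).

Lemma metric_delta (a b : 'I_4) : G *m delta_mx a b = dcoef (fun=> -1) a *: delta_mx a b :> 'M[R]_4.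
Proof.
apply/matrixP => i j; rewrite mul_bdiag !mxE; case: (altP (i =P a)) => [->//|_].
by rewrite !mulr0.
Qed.

Lemma delta_metric (a b : 'I_4) : delta_mx a b *m G = dcoef (fun=> -1) b *: delta_mx a b :> 'M[R]_4.
Proof. by apply: trmx_inj; rewrite trmx_mul bdiag_tr trmx_delta metric_delta linearZ /= trmx_delta. Qed.

Lemma dcoefN1_sqr a : dcoef (fun=> -1) a ^+ 2 = 1 :> R.
Proof. by move: a; apply: dcoefP => [|i]; rewrite ?dcoef0 ?dcoefS ?sqrrN expr1n. Qed.

Lemma gsign_sqr a b : gsign a b ^+ 2 = 1.
Proof. by rewrite /gsign exprMn !dcoefN1_sqr mulr1. Qed.

Lemma planar_lorentz a b c r : a != b -> 0 < c -> c ^+ 2 + gsign a b * r ^+ 2 = 1 ->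
  lorentz (planar a b c r).
Proof.
move=> ab c0 cs; split; last first.
  rewrite !mxE eqxx; move: ab; case: (eqVneq 0 a) => [<-|n1]; case: (eqVneq 0 b) => [<-|n2] //= _;
    rewrite ?mulr0 ?mulr1 ?addr0 ?subr0 ?add0r ?subrr ?mulr0 ?addr0 ?ltr01 //;
    by rewrite mulr1 subrKC.
have ga2 := dcoefN1_sqr a; have gb2 := dcoefN1_sqr b.
(* [P] projects onto the plane and [J] generates the motion in it. All products reduce to [Q = G P]
   and [T = G J]; the coefficient of [T] cancels and that of [Q] is [c^2 + g r^2 - 1]. *)
pose P := delta_mx a a + delta_mx b b : 'M[R]_4; pose g := gsign a b.
pose J := delta_mx a b - g *: delta_mx b a : 'M[R]_4.
rewrite [planar _ _ _ _](_ : _ = 1%:M + (c - 1) *: P + r *: J) //.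
have ba : b != a by rewrite eq_sym.
have dE := (mul_delta_mx_cond, eqxx, negbTE ab, negbTE ba, mulr1n, mulr0n, addr0, add0r, subr0, sub0r).
pose Q := dcoef (fun=> -1) a *: delta_mx a a + dcoef (fun=> -1) b *: delta_mx b b : 'M[R]_4.
pose T := dcoef (fun=> -1) a *: (delta_mx a b - delta_mx b a) : 'M[R]_4.
have GP : G *m P = Q by rewrite mulmxDr !metric_delta.
have PG : P *m G = Q by rewrite mulmxDl !delta_metric.
have PP : P *m Q = Q.
  by rewrite mulmxDr -!scalemxAr !mulmxDl !dE.
have gg : g * dcoef (fun=> -1) b = dcoef (fun=> -1) a by rewrite /g /gsign -mulrA -expr2 gb2 mulr1.
have GJ : G *m J = T.
  by rewrite mulmxBr -scalemxAr !metric_delta scalerA gg -scalerBr.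
have PT : P *m T = T by rewrite -scalemxAr mulmxDl !mulmxBr !dE.
have JE : J^T = delta_mx b a - g *: delta_mx a b.
  by rewrite linearB linearZ /= !trmx_delta.
have JG : J^T *m G = - T.
  by rewrite JE mulmxBl -scalemxAl !delta_metric scalerA gg -scalerBr -scalerN opprB.
have JQ : J^T *m Q = - T.
  rewrite JE mulmxBl mulmxDr -!scalemxAr -!scalemxAl mulmxDr -!scalemxAr !dE !scaler0 addr0 add0r.
  by rewrite scalerA gg -scalerBr -scalerN opprB.
have JT : J^T *m T = g *: Q.
  rewrite JE -scalemxAr mulmxBl -scalemxAl !mulmxBr !dE scalerN opprK scalerDr addrC.
  rewrite scalerDr !scalerA; congr (_ + _).
    by rewrite mulrC.
  by rewrite gg.
have PE : P^T = P by rewrite linearD /= !trmx_delta.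
have -> : (1%:M + (c - 1) *: P + r *: J)^T = 1%:M + (c - 1) *: P + r *: J^T.
  by rewrite linearD linearD !linearZ /= trmx1 PE.
have GL : G *m (1%:M + (c - 1) *: P + r *: J) = G + (c - 1) *: Q + r *: T.
  by rewrite mulmxDr mulmxDr mulmx1 -!scalemxAr GP GJ.
rewrite -mulmxA GL; rewrite -/g in cs; clearbody J Q T P g.
rewrite !mulmxDl !mul1mx -!scalemxAl !mulmxDr -!scalemxAr PG PP PT JG JQ JT.
have -> : G + (c - 1) *: Q + r *: T + (c - 1) *: (Q + (c - 1) *: Q + r *: T)
   + r *: (- T + (c - 1) *: - T + r *: (g *: Q))
  = G + ((c - 1) + (c - 1) + (c - 1) * (c - 1) + r * (r * g)) *: Q
      + (r + (c - 1) * r - r - r * (c - 1)) *: T.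
  by apply/matrixP => i j; rewrite !(mxE, summxE); ring.
have -> : (c - 1) + (c - 1) + (c - 1) * (c - 1) + r * (r * g) = c ^+ 2 + g * r ^+ 2 - 1 by ring.
rewrite cs subrr.
have -> : r + (c - 1) * r - r - r * (c - 1) = 0 by ring.
by rewrite !scale0r !addr0.
Qed.

Lemma trace_delta (A : 'M[R]_4) a b : \tr (A *m delta_mx a b) = A b a.
Proof.
rewrite /mxtrace (bigD1 b) //= !mxE (bigD1 a) //= big1 ?addr0 => [|k ka].
  rewrite !mxE !eqxx mulr1 big1 ?addr0 // => k kb; rewrite !mxE big1 // => j _.
  by rewrite !mxE (negbTE kb) andbF mulr0.
by rewrite !mxE (negbTE ka) mulr0.
Qed.

(** Stationarity under planar motions from the left and from the right gives two linear equations in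
    [X a b] and [X b a]. Their determinant is, up to sign, the difference of two squared weights,
    and the four weights [1, w i] have distinct squares. *)
Lemma stationary_diag w X : injective w -> (forall i, 0 < w i < 1) ->
  (forall L, lorentz L -> \tr (bdiag w *m X) <= \tr (bdiag w *m (L *m X))) ->
  (forall L, lorentz L -> \tr (bdiag w *m X) <= \tr (bdiag w *m (X *m L))) ->
  is_diag_mx X.
Proof.
move=> winj w01 hl hr; apply/is_diag_mxP => a b ab.
have ab' : a != b by apply: contra ab => /eqP ->.
have d_eq a' b' : dcoef w a' ^+ 2 = dcoef w b' ^+ 2 -> a' = b'.
  have w1 i : w i ^+ 2 < 1 by have /andP[h1 h2] := w01 i; rewrite expr_lt1 ?ltW.
  move: a' b'; apply: dcoefP => [|i]; apply: dcoefP => [|j] //; rewrite ?dcoef0 ?dcoefS ?expr1n.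
  - by move=> e; have := w1 j; rewrite -e ltxx.
  - by move=> e; have := w1 i; rewrite e ltxx.
  move=> /eqP; rewrite eqrXn2 //; last 2 first.
  - by have /andP[/ltW] := w01 i.
  - by have /andP[/ltW] := w01 j.
  by move=> /eqP/winj ->.
pose Wm := bdiag w.
have eL : dcoef w a * X b a - gsign a b * (dcoef w b * X a b) = 0.
  apply: (@conic_stationary (gsign a b) (\tr (Wm *m ((delta_mx a a + delta_mx b b) *m X)))).
    exact: gsign_sqr.
  move=> c r c0 cs; have := hl _ (planar_lorentz ab' c0 cs).
  have -> : \tr (Wm *m (planar a b c r *m X)) = \tr (Wm *m X)
      + (c - 1) * \tr (Wm *m ((delta_mx a a + delta_mx b b) *m X))
      + r * (\tr (Wm *m (delta_mx a b *m X)) - gsign a b * \tr (Wm *m (delta_mx b a *m X))).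
    rewrite /planar 2!mulmxDl mul1mx -!scalemxAl mulmxBl -scalemxAl.
    rewrite 2!mulmxDr -!scalemxAr mulmxBr -scalemxAr 2!mxtraceD !mxtraceZ.
    by rewrite linearB /= mxtraceZ.
  have tE i j : \tr (Wm *m (delta_mx i j *m X)) = dcoef w i * X j i.
    by rewrite mxtrace_mulC -mulmxA mxtrace_mulC trace_delta mul_mx_bdiag mulrC.
  by rewrite -addrA lerDl !tE.
have eR : dcoef w b * X b a - gsign a b * (dcoef w a * X a b) = 0.
  apply: (@conic_stationary (gsign a b) (\tr (Wm *m (X *m (delta_mx a a + delta_mx b b))))).
    exact: gsign_sqr.
  move=> c r c0 cs; have := hr _ (planar_lorentz ab' c0 cs).
  have -> : \tr (Wm *m (X *m planar a b c r)) = \tr (Wm *m X)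
      + (c - 1) * \tr (Wm *m (X *m (delta_mx a a + delta_mx b b)))
      + r * (\tr (Wm *m (X *m delta_mx a b)) - gsign a b * \tr (Wm *m (X *m delta_mx b a))).
    rewrite /planar; move: (delta_mx a a + delta_mx b b : 'M[R]_4) => P.
    rewrite 2!mulmxDr mulmx1 -!scalemxAr mulmxBr -scalemxAr.
    rewrite 2!mulmxDr -!scalemxAr mulmxBr -scalemxAr 2!mxtraceD !mxtraceZ.
    by rewrite linearB /= mxtraceZ.
  have tE i j : \tr (Wm *m (X *m delta_mx i j)) = dcoef w j * X j i.
    by rewrite mulmxA trace_delta mul_bdiag.
  by rewrite -addrA lerDl !tE.
(* Elimination of [X b a] from [eL] and [eR]. *)
have : gsign a b * ((dcoef w a ^+ 2 - dcoef w b ^+ 2) * X a b) = 0.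
  have -> : gsign a b * ((dcoef w a ^+ 2 - dcoef w b ^+ 2) * X a b)
    = dcoef w b * (dcoef w a * X b a - gsign a b * (dcoef w b * X a b))
      - dcoef w a * (dcoef w b * X b a - gsign a b * (dcoef w a * X a b)) by ring.
  by rewrite eL eR !mulr0 subr0.
have gn0 : gsign a b != 0 by rewrite -sqrf_eq0 gsign_sqr oner_eq0.
move=> /eqP; rewrite mulf_eq0 (negbTE gn0) /= mulf_eq0 subr_eq0 => /orP[/eqP/d_eq e|/eqP//].
by rewrite e eqxx in ab'.
Qed.

Lemma uniform_bound (f : 'I_3 -> R) : (forall i, `|f i| < 1) ->
  exists t, 0 < t < 1 /\ forall i, `|f i| <= t.
Proof.
(* The base value [2^-1] keeps the maximum positive, even for [f = 0]. *)
move=> f1; exists (\big[Num.max/2^-1]_i `|f i|); split; last by move=> i; exact: le_bigmax.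
apply/andP; split; last by apply/bigmax_ltP; split=> //; lra.
by apply: lt_le_trans (bigmax_ge_id _ _ _ _); lra.
Qed.

(** A Lorentz factor multiplied on either side of a minimizer is absorbed into [K1] or [K2], so
    [stationary_diag] applies. Minimality stays in the conclusion because [trace_lorentz_ge0]
    evaluates the minimum. *)
Lemma diag_normal_form w l m O : injective w -> (forall i, 0 < w i < 1) ->
  (forall i, `|l i| < 1) -> (forall i, `|m i| < 1) -> lorentz O ->
  let Y := bdiag l *m O *m bdiag m in
  exists K1 K2, [/\ lorentz K1, lorentz K2, is_diag_mx (K1 *m Y *m K2)
    & forall L1 L2, lorentz L1 -> lorentz L2 ->
      \tr (bdiag w *m (K1 *m Y *m K2)) <= \tr (bdiag w *m (L1 *m Y *m L2))].
Proof.
move=> winj w01 hl hm hO Y.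
have w1 i : `|w i| < 1 by have /andP[h1 h2] := w01 i; rewrite gtr0_norm.
have [tw [/andP[tw0 tw1] wt]] := uniform_bound w1.
have [tl [/andP[tl0 tl1] lt]] := uniform_bound hl.
have [tm [/andP[tm0 tm1] mt]] := uniform_bound hm.
pose t := Num.max tw (Num.max tl tm).
have t0 : 0 < t by rewrite lt_max tw0.
have t1 : t < 1 by rewrite !gt_max tw1 tl1.
pose f K1 K2 := \tr (bdiag w *m (K1 *m Y *m K2)).
have c0 : 0 < (1 - t) ^+ 3 by rewrite exprn_gt0 // subr_gt0.
have [|K1 K2 h1 h2|K1 [K2 [h1 h2 hmin]]] := @lorentz_minimum _ f _ c0.
- move=> T A B hA hB; rewrite /f /mxtrace; apply: continuous_sumr => i.
  apply: continuous_mulmx => [a b|]; first exact: cst_continuous.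
  do 2![apply: continuous_mulmx => //].
  by move=> a b; exact: cst_continuous.
- rewrite /f /Y; apply: trace_coercive; rewrite ?t0 ?t1 // => i.
  + by rewrite (le_trans (wt i)) // le_max lexx.
  + by rewrite (le_trans (lt i)) // !le_max lexx orbT.
  + by rewrite (le_trans (mt i)) // !le_max lexx !orbT.
exists K1, K2; split=> //; apply: (stationary_diag winj w01) => L hL.
  by have := hmin (L *m K1) K2 (lorentzM hL h1) h2; rewrite /f !mulmxA.
by have := hmin K1 (K2 *m L) h1 (lorentzM h2 hL); rewrite /f !mulmxA.
Qed.

Lemma offdiag0 X a b : is_diag_mx X -> a != b -> X a b = 0.
Proof. by move=> /is_diag_mxP hX ab; apply: hX. Qed.

(** This eliminates one Lorentz factor: for [X = L1 D L2] the left side contains [L2 *m G *m L2^T],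
    which is [G]. *)
Lemma diag_mul_metric X : is_diag_mx X -> X *m G *m X^T *m G = X *m X.
Proof.
move=> /is_diag_mxP hX.
have XT : X^T = X.
  apply/matrixP => a b; rewrite mxE; case: (eqVneq a b) => [->//|ab].
  by rewrite !hX // eq_sym.
have GX : G *m X = X *m G.
  apply/matrixP => a b; rewrite mul_bdiag mul_mx_bdiag; case: (eqVneq a b) => [->|ab].
    by rewrite mulrC.
  by rewrite hX // mulr0 mul0r.
by rewrite XT -(mulmxA X) GX mulmxA -mulmxA metric2 mulmx1.
Qed.

Lemma trace_lorentz_ge0 l m K1 K2 : injective l -> injective m ->
  (forall i, 0 < l i < 1) -> (forall i, 0 < m i < 1) ->
  (forall p : {perm 'I_3}, \sum_i l i * m (p i) <= 1) -> lorentz K1 -> lorentz K2 ->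
  0 <= \tr (bdiag l *m (K1 *m bdiag m *m K2)).
Proof.
move=> linj minj l01 m01 lm h1 h2.
(* [bdiag m] is split as [bdiag r *m 1 *m bdiag r] to fit [diag_normal_form]. *)
pose r i := Num.sqrt (m i).
have r1 i : `|r i| < 1.
  by have /andP[p q] := m01 i; rewrite ger0_norm ?sqrtr_ge0 // -sqrtr1 ltr_sqrt.
have rE : bdiag r *m 1%:M *m bdiag r = bdiag m.
  rewrite mulmx1 bdiagM; congr bdiag; apply/funext => i.
  by rewrite -expr2 sqr_sqrtr // ltW //; have /andP[] := m01 i.
have [L1 [L2 []]] := diag_normal_form linj l01 r1 r1 (lorentz1 R).
rewrite rE => hL1 hL2; set X := L1 *m _ *m L2 => Xd hmin.
apply: le_trans (hmin _ _ h1 h2); rewrite trace_bdiag.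
(* Writing the time entries as hyperbolic cosines, Cauchy-Schwarz gives at least [cosh u cosh v -
   sinh u sinh v = cosh (u - v)]. *)
have X0 : 1 <= X 0 0.
  have u1 := lorentz00_ge1 hL1; have u2 := lorentz00_ge1 hL2.
  have -> : X 0 0 = L1 0 0 * L2 0 0 + \sum_i L1 0 (lift ord0 i) * (m i * L2 (lift ord0 i) 0).
    rewrite /X -mulmxA mxE sum4 mul_bdiag dcoef0 mul1r; congr (_ + _).
    by apply: eq_bigr => i _; rewrite mul_bdiag dcoefS.
  suff : `|\sum_i L1 0 (lift ord0 i) * (m i * L2 (lift ord0 i) 0)| <= L1 0 0 * L2 0 0 - 1.
    by rewrite ler_norml => /andP[]; set z := \sum_i _; lra.
  apply: ler_norm_sqr; first by rewrite subr_ge0 mulr_ege1.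
  apply: le_trans (cauchy3 _ _) _.
  have e1 := lorentz_row0 hL1; have e2 := lorentz_col0 hL2.
  have : \sum_i (m i * L2 (lift ord0 i) 0) ^+ 2 <= \sum_i L2 (lift ord0 i) 0 ^+ 2.
    apply: ler_sum => i _; rewrite exprMn ler_piMl ?sqr_ge0 // expr_le1 ?ltW //;
    by have /andP[] := m01 i.
  move: e1 e2; set a := \sum_i _; set b := \sum_i _ ^+ 2; set c := \sum_i _ => e1 e2 cb.
  have a0 : 0 <= a by rewrite sumr_ge0 // => i _; exact: sqr_ge0.
  apply: (@le_trans _ _ (a * b)); first by rewrite ler_wpM2l.
  have -> : a = L1 0 0 ^+ 2 - 1 by rewrite -e1 addrAC subrr add0r.
  have -> : b = L2 0 0 ^+ 2 - 1 by rewrite -e2 addrAC subrr add0r.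
  rewrite -subr_ge0; have -> : (L1 0 0 * L2 0 0 - 1) ^+ 2 - (L1 0 0 ^+ 2 - 1) * (L2 0 0 ^+ 2 - 1)
    = (L1 0 0 - L2 0 0) ^+ 2 by ring.
  exact: sqr_ge0.
(* Entry [(a, b)] of [X^2 L1 = L1 D'^2]: a nonzero entry of [L1] equates two squared diagonal
   values. *)
have eig a b : L1 a b != 0 -> X a a ^+ 2 = dcoef m b ^+ 2.
  move=> nz; have : X *m X *m L1 = L1 *m (bdiag m *m bdiag m).
    have -> : X *m X *m L1 = L1 *m bdiag m *m (L2 *m G *m L2^T) *m bdiag m *m (L1^T *m G *m L1).
      by rewrite -diag_mul_metric // /X !trmx_mul bdiag_tr !mulmxA.
    case: hL1 => -> _; have [+ _] := lorentz_tr hL2; rewrite trmxK => ->.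
    by rewrite -!mulmxA (bdiagC m) (mulmxA _ _ (bdiag m)) metric2 mul1mx.
  move=> /matrixP/(_ a b); rewrite bdiagM mul_mx_bdiag mxE (bigD1 a) //= big1 ?addr0.
    rewrite mxE (bigD1 a) //= big1 ?addr0 => [e|k ka]; last by rewrite (offdiag0 Xd) ?mul0r // eq_sym.
    apply: (mulfI nz); rewrite mulrC expr2 e; congr (_ * _).
    by move: b {nz e}; apply: dcoefP => [|i]; rewrite ?dcoef0 ?dcoefS ?expr1n ?expr2.
  move=> k ka; rewrite mxE big1 ?mul0r // => j _.
  case: (eqVneq a j) => [<-|aj]; last by rewrite (offdiag0 Xd aj) mul0r.
  by rewrite (offdiag0 Xd (_ : a != k)) ?mulr0 // eq_sym.
(* A spatial row of [L1] has Minkowski square [-1], so its spatial part is nonzero. *)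
have hp i : exists j, L1 (lift ord0 i) (lift ord0 j) != 0.
  apply/existsP; rewrite -[X in is_true X]negbK negb_exists; apply/negP => /forallP h.
  have := lorentz_row (lift ord0 i) (lift ord0 i) hL1; rewrite mxE eqxx mulr1n mxE dcoefS.
  rewrite [X in _ - X]big1 ?subr0 => [e|j _].
    by have := sqr_ge0 (L1 (lift ord0 i) 0); rewrite expr2 e; lra.
  by have := h j; rewrite negbK => /eqP ->; rewrite mul0r.
have [p hp'] := fin_all_exists hp.
have m_eq j b : dcoef m b ^+ 2 = m j ^+ 2 -> b = lift ord0 j.
  have m0 i : 0 <= m i by have /andP[/ltW] := m01 i.
  move: b; apply: dcoefP => [|k]; rewrite ?dcoef0 ?dcoefS.
    rewrite expr1n => e; have : m j ^+ 2 < 1 by rewrite expr_lt1 //; have /andP[] := m01 j.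
    by rewrite -e ltxx.
  by move=> /eqP; rewrite eqrXn2 // => /eqP/minj ->.
have xE i : X (lift ord0 i) (lift ord0 i) ^+ 2 = m (p i) ^+ 2 by rewrite (eig _ _ (hp' i)) dcoefS.
(* Since [1] and the [m j] have distinct squares, the matching column is unique: row [i] of [L1] is
   supported on one column. *)
have supp i b : b != lift ord0 (p i) -> L1 (lift ord0 i) b = 0.
  move=> nb; apply/eqP/negPn/negP => /eig; rewrite xE => /esym/m_eq e.
  by rewrite e eqxx in nb.
(* Two rows supported on the same column could not be Minkowski-orthogonal. *)
have pinj : injective p.
  move=> i i' e; apply/eqP/negPn/negP => ii'.
  have := lorentz_row (lift ord0 i) (lift ord0 i') hL1.
  rewrite (supp i) // mul0r sub0r (bigD1 (p i)) //= big1 ?addr0 => [|j jp]; last first.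
    by rewrite supp ?mul0r // (inj_eq lift_inj).
  rewrite mxE (inj_eq lift_inj) (negbTE ii') mulr0n => /eqP; rewrite oppr_eq0 mulf_eq0.
  by rewrite (negbTE (hp' i)) e (negbTE (hp' i')).
have := lm (perm pinj); under eq_bigr do rewrite permE.
have : - \sum_i l i * m (p i) <= \sum_i l i * X (lift ord0 i) (lift ord0 i).
  rewrite -sumrN; apply: ler_sum => i _; rewrite -mulrN ler_wpM2l //.
    by have /andP[/ltW] := l01 i.
  have : `|X (lift ord0 i) (lift ord0 i)| <= m (p i).
    by apply: ler_norm_sqr; rewrite ?xE //; have /andP[/ltW] := m01 (p i).
  by rewrite ler_norml => /andP[].
set u := \sum_i _; set v := \sum_i _; lra.
Qed.

(* Unnormalized separable states, as correlation matrices. *)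
Definition csep M := exists r : seq ('cV[R]_4 * 'cV[R]_4),
  (forall p, p \in r -> fcone p.1 /\ fcone p.2) /\ M = \sum_(p <- r) p.1 *m p.2^T.

Lemma csep_prod x y : fcone x -> fcone y -> csep (x *m y^T).
Proof.
move=> hx hy; exists [:: (x, y)]; rewrite big_seq1; split=> // p.
by rewrite inE => /eqP ->.
Qed.

Lemma csep0 : csep 0.
Proof. by exists [::]; rewrite big_nil. Qed.

Lemma csepD M N : csep M -> csep N -> csep (M + N).
Proof.
move=> [r [hr ->]] [q [hq ->]]; exists (r ++ q); rewrite big_cat; split=> // p.
by rewrite mem_cat => /orP[/hr|/hq].
Qed.

Lemma csep_sum (I : finType) (F : I -> 'M[R]_4) : (forall i, csep (F i)) -> csep (\sum_i F i).
Proof.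
move=> hF; elim: (index_enum I) => [|i r IH]; first by rewrite big_nil; exact: csep0.
by rewrite big_cons; apply: csepD.
Qed.

Lemma csep_mul A B M : (forall x, fcone x -> fcone (A *m x)) ->
  (forall x, fcone x -> fcone (B^T *m x)) -> csep M -> csep (A *m M *m B).
Proof.
move=> hA hB [r [hr ->]]; exists [seq (A *m p.1, B^T *m p.2) | p <- r]; split.
  by move=> _ /mapP[p /hr [h1 h2] ->]; split; [apply: hA | apply: hB].
rewrite big_map mulmx_sumr mulmx_suml; apply: eq_bigr => p _ /=.
by rewrite trmx_mul trmxK !mulmxA.
Qed.

Lemma fconeZ c x : 0 <= c -> fcone x -> fcone (c *: x).
Proof.
move=> c0 [x0 hx]; split; rewrite !mxE ?mulr_ge0 // exprMn.
under eq_bigr do rewrite mxE exprMn; by rewrite -mulr_sumr ler_wpM2l ?sqr_ge0.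
Qed.

Lemma csepZ c M : 0 <= c -> csep M -> csep (c *: M).
Proof.
move=> c0 hM; have -> : c *: M = c%:M *m M *m 1%:M by rewrite mulmx1 mul_scalar_mx.
apply: csep_mul hM => x hx; first by rewrite mul_scalar_mx; apply: fconeZ.
by rewrite trmx1 mul1mx.
Qed.

(** Each [e0 e0^T + r ei ei^T] with [r = 1] or [-1] is an average of two products of the light-like
    vectors [e0 + ei] and [e0 - ei]. Weights [|X_ii|] on these and the slack on [e0 e0^T] rebuild
    [X]. This is the octahedron of separable Bell-diagonal states. *)
Lemma csep_diag X : is_diag_mx X -> \sum_i `|X (lift ord0 i) (lift ord0 i)| <= X 0 0 -> csep X.
Proof.
move=> Xd hX; pose e (a : 'I_4) : 'cV[R]_4 := delta_mx a 0.
have he i (r : R) : r ^+ 2 = 1 -> fcone (e 0 + r *: e (lift ord0 i)).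
  move=> r2; split; rewrite !mxE /= ?mulr0 ?addr0 ?ler01 //.
  rewrite (bigD1 i) //= big1 ?addr0 => [|j ji]; rewrite !mxE /= (inj_eq lift_inj).
    by rewrite eqxx add0r mulr1 r2 expr1n.
  by rewrite (negbTE ji) /= mulr0 add0r expr0n.
have hE i (r : R) : r ^+ 2 = 1 -> csep (delta_mx 0 0 + r *: delta_mx (lift ord0 i) (lift ord0 i)).
  move=> r2.
  have -> : delta_mx 0 0 + r *: delta_mx (lift ord0 i) (lift ord0 i)
     = 2^-1 *: ((e 0 + 1 *: e (lift ord0 i)) *m (e 0 + r *: e (lift ord0 i))^T
         + (e 0 + -1 *: e (lift ord0 i)) *m (e 0 + (- r) *: e (lift ord0 i))^T) :> 'M[R]_4.
    have tE (q : R) : (e 0 + q *: e (lift ord0 i))^T = delta_mx 0 0 + q *: delta_mx 0 (lift ord0 i).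
      by rewrite linearD linearZ /= !trmx_delta.
    rewrite !tE /e !mulmxDl !mulmxDr -!scalemxAl -!scalemxAr !mul_delta_mx.
    by apply/matrixP => a b; rewrite !mxE; field.
  apply: csepZ; first by rewrite invr_ge0.
  by apply: csepD; apply: csep_prod; apply: he; rewrite ?sqrrN ?expr1n.
pose sg (z : R) : R := if 0 <= z then 1 else -1.
have sg2 z : sg z ^+ 2 = 1 by rewrite /sg; case: ifP; rewrite ?sqrrN expr1n.
have sgE z : `|z| * sg z = z.
  rewrite /sg; case: ifP => h; first by rewrite mulr1 ger0_norm.
  by rewrite ltr0_norm ?mulrN1 ?opprK // ltNge h.
pose S := \sum_i `|X (lift ord0 i) (lift ord0 i)|.
have -> : X = (X 0 0 - S) *: (e 0 *m (e 0)^T) + \sum_i `|X (lift ord0 i) (lift ord0 i)| *: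
   (delta_mx 0 0 + sg (X (lift ord0 i) (lift ord0 i)) *: delta_mx (lift ord0 i) (lift ord0 i)).
  under eq_bigr do rewrite scalerDr scalerA sgE.
  rewrite big_split /= -scaler_suml -/S trmx_delta mul_delta_mx addrA -scalerDl subrK.
  apply/matrixP => a b; rewrite !mxE summxE; case: (eqVneq a b) => [<-|ab]; last first.
    have n (k : 'I_4) : ((a == k) && (b == k))%:R = 0 :> R.
      by case: eqP => //= <-; rewrite eq_sym (negbTE ab).
    by rewrite (offdiag0 Xd ab) n mulr0 add0r big1 // => i _; rewrite !mxE n mulr0.
  move: a; apply: dcoefP => [|i].
    by rewrite /= mulr1 big1 ?addr0 // => i _; rewrite !mxE /= mulr0.
  rewrite /= mulr0 add0r (bigD1 i) //= !mxE eqxx mulr1 big1 ?addr0 // => j ji.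
  by rewrite !mxE (inj_eq lift_inj) eq_sym (negbTE ji) mulr0.
apply: csepD.
  by apply: csepZ; [rewrite subr_ge0 | apply: csep_prod; apply: e0_fcone].
by apply: csep_sum => i; apply: csepZ => //; apply: hE.
Qed.

(** Lorentz factors preserve the cone, so only the diagonal normal form has to be decomposed. *)
Lemma csep_generic l m O : injective l -> injective m ->
  (forall i, 0 < l i < 1) -> (forall i, 0 < m i < 1) ->
  (forall p : {perm 'I_3}, \sum_i l i * m (p i) <= 1) -> lorentz O ->
  csep (bdiag l *m O *m bdiag m).
Proof.
move=> linj minj l01 m01 lm hO.
have le1 (f : 'I_3 -> R) : (forall i, 0 < f i < 1) -> forall i, `|f i| < 1.
  by move=> h i; have /andP[h1 h2] := h i; rewrite gtr0_norm.
have [K1 [K2 []]] := diag_normal_form linj l01 (le1 _ l01) (le1 _ m01) hO.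
set X := K1 *m _ *m K2 => h1 h2 Xd _.
have [L1 hL1 [_ e1]] := lorentzV h1; have [L2 hL2 [e2 _]] := lorentzV h2.
have -> : bdiag l *m O *m bdiag m = L1 *m X *m L2.
  by rewrite /X !mulmxA e1 mul1mx -!mulmxA e2 mulmx1.
apply: csep_mul => [x|x|]; [exact: fcone_lorentz | exact/fcone_lorentz/lorentz_tr |].
apply: csep_diag Xd _.
(* Signs opposite to the diagonal turn the trace into [X 0 0 - \sum_i |X_ii|]; by cyclicity it is a
   trace covered by [trace_lorentz_ge0]. *)
pose s i : R := if 0 <= X (lift ord0 i) (lift ord0 i) then -1 else 1.
have s2 i : s i ^+ 2 = 1 by rewrite /s; case: ifP; rewrite ?sqrrN expr1n.
have := trace_lorentz_ge0 linj minj l01 m01 lm hO (lorentzM (lorentzM h2 (bdiag_lorentz s2)) h1).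
have -> : \tr (bdiag l *m (O *m bdiag m *m (K2 *m bdiag s *m K1))) = \tr (bdiag s *m X).
  by rewrite /X mxtrace_mulC [RHS]mxtrace_mulC -!mulmxA [RHS]mxtrace_mulC -!mulmxA
     [RHS]mxtrace_mulC -!mulmxA mxtrace_mulC -!mulmxA.
rewrite trace_bdiag => h; rewrite -subr_ge0; apply: le_trans h _.
rewrite lerD2l -sumrN; apply: ler_sum => i _; rewrite /s; case: ifP => h.
  by rewrite mulN1r ger0_norm.
by rewrite mul1r ltr0_norm ?opprK // ltNge h.
Qed.

End NormalForm.

(** * Pure correlation matrices and reduction to the generic case *)

Section Perturbation.
Variable R : realType.
Implicit Types (l m s w : 'I_3 -> R) (K L M O X W : 'M[R]_4) (x y : 'cV[R]_4).
Local Notation G := (bdiag (fun=> -1)).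

Definition pure_corr M :=
  (exists x y, [/\ fcone x, fcone y & M = x *m y^T]) \/
  (exists k O, [/\ 0 <= k, lorentz O & M = k *: O]).

Lemma conformal_col M k a b : M^T *m G *m M = k *: G ->
  M 0 a * M 0 b - \sum_i M (lift ord0 i) a * M (lift ord0 i) b = k * G a b.
Proof.
move=> /matrixP/(_ a b); rewrite mxE sum4 mul_mx_bdiag dcoef0 mxE mulr1 [RHS]mxE => <-.
congr (_ + _); rewrite -sumrN; apply: eq_bigr => i _.
by rewrite mul_mx_bdiag dcoefS mxE mulrN1 mulNr.
Qed.

(** For [k > 0], dividing by [k] gives a Lorentz matrix. For [k = 0] the columns are light-like and
    mutually Minkowski-orthogonal, hence proportional, and [M] is an outer product. *)
Lemma conformal_pure M k : 0 <= k -> M^T *m G *m M = k ^+ 2 *: G -> M *m G *m M^T = k ^+ 2 *: G ->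
  0 <= M 0 0 -> pure_corr M.
Proof.
move=> k0 hc hr M0.
have G0 a : G 0 a = (a == 0)%:R :> R by rewrite !mxE [a == 0]eq_sym; case: eqP => // _; rewrite dcoef0.
have sq_sum0 (f : 'I_3 -> R) : \sum_i f i ^+ 2 = 0 -> forall i, f i = 0.
  move=> /eqP; rewrite psumr_eq0 => [/allP h i|i _]; last exact: sqr_ge0.
  by apply/eqP; rewrite -sqrf_eq0; apply: h; rewrite mem_index_enum.
have c00 := conformal_col 0 0 hc.
move: k0; rewrite le_eqVlt => /orP[/eqP k0|k0]; last first.
  right; exists k, (k^-1 *: M); split; first exact: ltW.
    split.
      have -> : (k^-1 *: M)^T = k^-1 *: M^T by rewrite linearZ.
      rewrite -!scalemxAl -scalemxAr hc !scalerA.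
      by rewrite (_ : _ * _ = 1) ?scale1r //; field; rewrite gt_eqF.
    (* If [M 0 0] vanished, column 0 would have a nonpositive Minkowski square, but that square is
       [k^2]. *)
    rewrite mxE mulr_gt0 ?invr_gt0 // lt_neqAle M0 andbT eq_sym; apply/eqP => e.
    have : 0 <= \sum_i M (lift ord0 i) 0 * M (lift ord0 i) 0.
      by apply: sumr_ge0 => i _; rewrite -expr2 sqr_ge0.
    have := exprn_gt0 2 k0; move: c00; rewrite e mulr0 sub0r G0 eqxx mulr1 => <-.
    by rewrite oppr_gt0 leNgt => ->.
  by rewrite scalerA divff ?scale1r // gt_eqF.
left; rewrite -k0 expr0n /= in hc hr c00.
have hcc a b : M 0 a * M 0 b = \sum_i M (lift ord0 i) a * M (lift ord0 i) b.
  by apply/eqP; rewrite -subr_eq0 (conformal_col _ _ hc) mul0r.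
have hrr : M 0 0 * M 0 0 = \sum_i M 0 (lift ord0 i) * M 0 (lift ord0 i).
  have hr' : (M^T)^T *m G *m M^T = 0 *: G by rewrite trmxK.
  have := conformal_col 0 0 hr'; rewrite mul0r => /eqP; rewrite subr_eq0 => /eqP.
  by rewrite !mxE; under eq_bigr do rewrite !mxE.
case: (eqVneq (M 0 0) 0) => [e|nz].
  have row0 j : M 0 (lift ord0 j) = 0.
    by apply: (sq_sum0 (fun j => M 0 (lift ord0 j))); rewrite -[RHS](mulr0 (M 0 0)) -[in RHS]e hrr.
  have row a : M 0 a = 0 by move: a; apply: dcoefP.
  exists 0, 0; split.
  - by split; rewrite ?mxE // expr0n big1 // => i _; rewrite mxE expr0n.
  - by split; rewrite ?mxE // expr0n big1 // => i _; rewrite mxE expr0n.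
  rewrite mul0mx; apply/matrixP => a b; rewrite mxE; move: a; apply: dcoefP => [|i]; first exact: row.
  by apply: (sq_sum0 (fun i => M (lift ord0 i) b)); rewrite -[RHS](mulr0 (M 0 b)) -[in RHS](row b) hcc.
exists (col 0 M), ((M 0 0)^-1 *: (row 0 M)^T); split.
- split; rewrite !mxE // expr2 hcc le_eqVlt; apply/orP; left; apply/eqP.
  by apply: eq_bigr => i _; rewrite !mxE.
- split; rewrite !mxE ?mulVf // expr1n.
  have -> : \sum_i ((M 0 0)^-1 *: (row 0 M)^T) (lift ord0 i) 0 ^+ 2
     = (M 0 0)^-1 ^+ 2 * \sum_i M 0 (lift ord0 i) * M 0 (lift ord0 i).
    by rewrite mulr_sumr; apply: eq_bigr => i _; rewrite !mxE exprMn -expr2.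
  by rewrite -hrr -expr2 -exprMn mulVf // expr1n.
rewrite linearZ /= trmxK -scalemxAr; apply/matrixP => a b; rewrite !mxE big_ord1 !mxE.
move: a; apply: dcoefP => [|i]; first by field.
apply/eqP; rewrite -subr_eq0; apply/eqP.
(* The deviation of column [b] from its multiple of column 0 has zero sum of squares, by the
   orthogonality relations [hcc]. *)
apply: (sq_sum0 (fun i => M (lift ord0 i) b - (M 0 0)^-1 * (M (lift ord0 i) 0 * M 0 b))).
have -> : \sum_i (M (lift ord0 i) b - (M 0 0)^-1 * (M (lift ord0 i) 0 * M 0 b)) ^+ 2
  = \sum_i M (lift ord0 i) b * M (lift ord0 i) b
    - (2 * M 0 b / M 0 0) * \sum_i M (lift ord0 i) 0 * M (lift ord0 i) b
    + (M 0 b / M 0 0) ^+ 2 * \sum_i M (lift ord0 i) 0 * M (lift ord0 i) 0.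
  by rewrite !mulr_sumr -sumrB -big_split /=; apply: eq_bigr => j _; field.
by rewrite -!hcc; field.
Qed.

(* Adding multiples of the rank (ties broken by the index) makes the values
   distinct without creating new coincidences. *)
Lemma rank_perturbation l e : (forall i, 0 <= l i <= 1) -> 0 < e -> 10 * e <= 1 ->
  exists d : 'I_3 -> R, let l' := fun i => (1 - 10 * e) * l i + e * d i in
  [/\ forall i, 1 <= d i <= 3, injective l', forall i, 0 < l' i < 1
    & forall i, `|l i - l' i| <= 13 * e].
Proof.
move=> l01 e0 e1.
pose below i := [pred k : 'I_3 | (l k < l i) || ((l k == l i) && (k <= i)%N)].
pose d i : R := #|below i|%:R; exists d => l'.
have self i : i \in below i by rewrite inE eqxx leqnn orbT.
have d13 i : 1 <= d i <= 3.
  rewrite ler1n; apply/andP; split; first by apply/card_gt0P; exists i; exact: self.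
  by rewrite ler_nat (leq_trans (max_card _)) // card_ord.
have dlt i j : (l i < l j) || ((l i == l j) && (i < j)%N) -> d i < d j.
  move=> ij; rewrite ltr_nat; apply: proper_card; apply/fintype.properP; split.
    apply/fintype.subsetP => k; rewrite !inE => /orP[ki|/andP[/eqP ki kli]].
      by case/orP: ij => [/(lt_trans ki) ->//|/andP[/eqP <- _]]; rewrite ki.
    rewrite ki; case/orP: ij => [->//|/andP[-> /ltnW/(leq_trans kli) ->]]; exact: orbT.
  exists j => //; rewrite inE; case/orP: ij => [ij|/andP[/eqP e2 ij]].
    by rewrite ltNge (ltW ij) /= gt_eqF.
  by rewrite e2 ltxx eqxx leqNgt ij.
have llt i j : (l i < l j) || ((l i == l j) && (i < j)%N) -> l' i < l' j.
  move=> ij; rewrite /l' ler_ltD //; last by rewrite ltr_pM2l // dlt.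
  rewrite ler_wpM2l ?subr_ge0 //; case/orP: ij => [/ltW//|/andP[/eqP -> _]//].
split=> //.
- move=> i j lij; apply/eqP/negPn/negP => ij.
  case: (ltgtP (l i) (l j)) => [h|h|h].
  + by have := llt i j; rewrite h => /(_ isT); rewrite lij ltxx.
  + by have := llt j i; rewrite h => /(_ isT); rewrite lij ltxx.
  case: (ltngtP i j) => [h'|h'|/val_inj e2]; last by rewrite e2 eqxx in ij.
  + by have := llt i j; rewrite h h' eqxx orbT => /(_ isT); rewrite lij ltxx.
  + by have := llt j i; rewrite h h' eqxx orbT => /(_ isT); rewrite lij ltxx.
- move=> i; have /andP[a1 a2] := l01 i; have /andP[b1 b2] := d13 i.
  rewrite /l'; apply/andP; split.
    have : 0 <= (1 - 10 * e) * l i by rewrite mulr_ge0 ?subr_ge0.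
    have : 0 < e * d i by rewrite mulr_gt0 //; lra.
    lra.
  have : (1 - 10 * e) * l i <= (1 - 10 * e) * 1 by rewrite ler_wpM2l ?subr_ge0.
  have : e * d i <= e * 3 by rewrite ler_wpM2l // ltW.
  lra.
- move=> i; have /andP[a1 a2] := l01 i; have /andP[b1 b2] := d13 i.
  rewrite (_ : l i - l' i = 10 * e * l i - e * d i); last by rewrite /l'; ring.
  have : e * l i <= e * 1 by rewrite ler_wpM2l // ltW.
  have : 0 <= e * l i by rewrite mulr_ge0 // ltW.
  have : e * d i <= e * 3 by rewrite ler_wpM2l // ltW.
  have : 0 <= e * d i by rewrite mulr_ge0 ?ltW //; lra.
  rewrite ler_norml -(mulrA 10); set u := e * l i; set v := e * d i => *.
  by apply/andP; split; lra.
Qed.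

Lemma sum3_le (f : 'I_3 -> R) c : (forall i, f i <= c) -> \sum_i f i <= 3 * c.
Proof.
move=> h; apply: (le_trans (ler_sum _ (fun i _ => h i))).
by rewrite sumr_const card_ord mulr_natl.
Qed.

Lemma bdiag_abs l : exists s, (forall i, s i ^+ 2 = 1) /\ forall i, l i = s i * `|l i|.
Proof.
exists (fun i => if 0 <= l i then 1 else -1); split=> i; case: ifP => h.
- by rewrite expr1n.
- by rewrite sqrrN expr1n.
- by rewrite mul1r ger0_norm.
- by rewrite mulN1r ltr0_norm ?opprK // ltNge h.
Qed.

(** The absolute values are perturbed to generic ones, each pure term is decomposed separately, and
    the signs are put back as Lorentz matrices. Entry [(0, 0)], the trace, never changes. *)
Lemma csep_approx n (Rk : 'I_n -> 'M[R]_4) l m e :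
  (forall k, pure_corr (Rk k)) ->
  (forall i, `|l i| <= 1) -> (forall i, `|m i| <= 1) ->
  (forall p : {perm 'I_3}, \sum_i `|l i| * `|m (p i)| <= 1) -> 0 < e ->
  let M := bdiag l *m (\sum_k Rk k) *m bdiag m in
  exists M', [/\ csep M', M' 0 0 = M 0 0 & forall a b, `|M a b - M' a b| <= e].
Proof.
move=> pureR hl hm lm e0 M; set Q := \sum_k Rk k in M *.
pose B := 1 + \sum_a \sum_b `|Q a b|.
have B1 : 1 <= B by rewrite lerDl sumr_ge0 // => a _; rewrite sumr_ge0.
have QB a b : `|Q a b| <= B.
  rewrite /B (bigD1 a) //= (bigD1 b) //=.
  have h1 : 0 <= \sum_(j | j != b) `|Q a j| by rewrite sumr_ge0.
  have h2 : 0 <= \sum_(i | i != a) \sum_j `|Q i j| by rewrite sumr_ge0 // => i _; rewrite sumr_ge0.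
  lra.
(* Each diagonal factor moves by at most [13 t], so an entry moves by at most [26 t B]; the bound
   [1 / 10] keeps [1 - 10 t] nonnegative. *)
pose t := Num.min (1 / 10) (e / (26 * B)).
have t0 : 0 < t by rewrite lt_min; apply/andP; split; [lra | rewrite divr_gt0 //; lra].
have t1 : 10 * t <= 1.
  have : t <= 1 / 10 by rewrite ge_min lexx.
  lra.
have tB : 26 * t * B <= e.
  have : t <= e / (26 * B) by rewrite ge_min lexx orbT.
  rewrite ler_pdivlMr; last by lra.
  by rewrite mulrA (mulrC t).
have [s [s2 ls]] := bdiag_abs l; have [r [r2 mr]] := bdiag_abs m.
have abs01 (f : 'I_3 -> R) : (forall i, `|f i| <= 1) -> forall i, 0 <= `|f i| <= 1.
  by move=> h i; rewrite normr_ge0 h.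
have [d [d13 linj l01 ld]] := rank_perturbation (abs01 _ hl) t0 t1.
have [d' [d13' minj m01 md]] := rank_perturbation (abs01 _ hm) t0 t1.
move: linj l01 ld minj m01 md.
set l' := fun i => _; set m' := fun i => _ => linj l01 ld minj m01 md.
(* To first order, shrinking both families loses [20 t], while the ranks, at most 3, add at most
   [3 * (3 + 3) * t = 18 t]. This dictates the constant 10. *)
have lm' (p : {perm 'I_3}) : \sum_i l' i * m' (p i) <= 1.
  have -> : \sum_i l' i * m' (p i) = (1 - 10 * t) ^+ 2 * (\sum_i `|l i| * `|m (p i)|)
     + \sum_i ((1 - 10 * t) * t * (d i * `|m (p i)| + d' (p i) * `|l i|) + t ^+ 2 * (d i * d' (p i))).
    by rewrite mulr_sumr -big_split /=; apply: eq_bigr => i _; rewrite /l' /m'; ring.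
  have h1 : (1 - 10 * t) ^+ 2 * (\sum_i `|l i| * `|m (p i)|) <= (1 - 10 * t) ^+ 2 * 1.
    by rewrite ler_wpM2l ?sqr_ge0.
  have h2 : \sum_i ((1 - 10 * t) * t * (d i * `|m (p i)| + d' (p i) * `|l i|) + t ^+ 2 * (d i * d' (p i)))
     <= 3 * ((1 - 10 * t) * t * (3 * 1 + 3 * 1) + t ^+ 2 * (3 * 3)).
    apply: sum3_le => i; have /andP[a1 a2] := d13 i; have /andP[b1 b2] := d13' (p i).
    have d0 : 0 <= d i by lra.
    have d0' : 0 <= d' (p i) by lra.
    apply: lerD; apply: ler_wpM2l.
    - by rewrite mulr_ge0 ?subr_ge0 // ltW.
    - by apply: lerD; apply: ler_pM.
    - exact: sqr_ge0.
    - exact: ler_pM.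
  apply: (le_trans (lerD h1 h2)).
  have -> : (1 - 10 * t) ^+ 2 * 1 + 3 * ((1 - 10 * t) * t * (3 * 1 + 3 * 1) + t ^+ 2 * (3 * 3))
    = 1 - 2 * t - 53 * t ^+ 2 by ring.
  have := sqr_ge0 t; lra.
have lt1 (f : 'I_3 -> R) : (forall i, 0 < f i < 1) -> forall i, `|f i| <= 1.
  by move=> h i; have /andP[h1 h2] := h i; rewrite gtr0_norm // ltW.
pose N := bdiag l' *m Q *m bdiag m'.
have sepN : csep N.
  rewrite /N /Q mulmx_sumr mulmx_suml; apply: csep_sum => k.
  case: (pureR k) => [] [x [y [] ] ] => [hx hy ->|c0 hO ->].
    apply: csep_mul (csep_prod hx hy) => z hz; rewrite ?bdiag_tr; exact/fcone_bdiag/hz/lt1.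
  by rewrite -scalemxAr -scalemxAl; apply: (csepZ c0); exact: csep_generic.
have fs (q : 'I_3 -> R) z : (forall i, q i ^+ 2 = 1) -> fcone z -> fcone (bdiag q *m z).
  by move=> q2 hz; apply: fcone_lorentz => //; exact: bdiag_lorentz.
exists (bdiag s *m N *m bdiag r); split.
- by apply: csep_mul sepN => z hz; rewrite ?bdiag_tr; apply: fs.
- by rewrite /N /M !(mul_mx_bdiag, mul_bdiag) !dcoef0 !mul1r !mulr1.
move=> a b; rewrite /N /M !(mul_mx_bdiag, mul_bdiag).
have dE (q f g : 'I_3 -> R) c : (forall i, q i ^+ 2 = 1) -> (forall i, f i = q i * `|f i|) ->
    (forall i, `|f i| <= 1) -> (forall i, 0 < g i < 1) -> (forall i, `| `|f i| - g i| <= 13 * t) ->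
    [/\ `|dcoef f c - dcoef q c * dcoef g c| <= 13 * t, `|dcoef f c| <= 1
      & `|dcoef q c * dcoef g c| <= 1].
  move=> q2 fq f1 g01 fg; move: c; apply: dcoefP => [|i]; rewrite ?dcoef0 ?dcoefS.
    by rewrite mulr1 subrr normr0 normr1 mulr_ge0 // ltW.
  have q1 : `|q i| = 1.
    by apply/eqP; rewrite -(@eqrXn2 _ 2) // real_normK ?num_real // q2 expr1n.
  split; last by rewrite normrM q1 mul1r lt1.
    by rewrite [f i]fq -mulrBr normrM q1 mul1r fg.
  exact: f1.
have [x1 x2 x3] := dE s l l' a s2 ls hl l01 ld.
have [y1 y2 y3] := dE r m m' b r2 mr hm m01 md.
(* The difference of the two products is telescoped so that only one factor changes at a time. *)
have -> : dcoef l a * Q a b * dcoef m b - dcoef s a * (dcoef l' a * Q a b * dcoef m' b) * dcoef r b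
  = Q a b * ((dcoef l a - dcoef s a * dcoef l' a) * dcoef m b
      + dcoef s a * dcoef l' a * (dcoef m b - dcoef r b * dcoef m' b)) by ring.
apply: le_trans tB; rewrite normrM mulrC.
apply: (@ler_pM _ _ (26 * t) _ B) => //.
apply: (le_trans (ler_normD _ _)); rewrite [X in X + _]normrM [X in _ + X]normrM.
have -> : 26 * t = 13 * t * 1 + 1 * (13 * t) by ring.
by apply: lerD; apply: ler_pM.
Qed.

End Perturbation.

(** * Bloch representation *)

Section Bloch.
Local Open Scope complex_scope.
Local Open Scope sesquilinear_scope.
Variable R : realType.
Local Notation C := R[i].
Local Notation G := (bdiag (fun=> -1 : R)).

Lemma conjCE (a b : R) : Num.conj (a +i* b) = a -i* b :> C.
Proof. by []. Qed.

Lemma sum2 (V : nmodType) (F : 'I_2 -> V) : \sum_i F i = F 0 + F 1.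
Proof. by rewrite !big_ord_recl big_ord0 addr0; congr (_ + F _); apply/val_inj. Qed.

Lemma sum_tens (V : nmodType) p q (F : 'I_(p * q) -> V) :
  \sum_r F r = \sum_i \sum_j F (mxtens_index (i, j)).
Proof.
rewrite pair_bigA /= (reindex (@mxtens_index p q)) /=; first by apply: eq_bigr => -[].
by exists (@mxtens_unindex p q) => i _; rewrite ?mxtens_indexK ?mxtens_unindexK.
Qed.

Lemma ord4P (P : 'I_4 -> Prop) :
  P 0 -> P 1 -> P (inord 2) -> P (inord 3) -> forall a, P a.
Proof.
move=> P0 P1 P2 P3 [[|[|[|[|//]]]] h].
- by rewrite (_ : Ordinal h = 0) //; apply/val_inj.
- by rewrite (_ : Ordinal h = 1) //; apply/val_inj.
- by rewrite (_ : Ordinal h = inord 2) //; apply/val_inj; rewrite /= inordK.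
- by rewrite (_ : Ordinal h = inord 3) //; apply/val_inj; rewrite /= inordK.
Qed.

Lemma ord2P (P : 'I_2 -> Prop) : P 0 -> P 1 -> forall a, P a.
Proof.
move=> P0 P1 [[|[|//]] h].
- by rewrite (_ : Ordinal h = 0) //; apply/val_inj.
- by rewrite (_ : Ordinal h = 1) //; apply/val_inj.
Qed.

Lemma pauli0 : pauli R 0 = 1%:M. Proof. by []. Qed.
Lemma pauli1 : pauli R 1 = mx2 0 1 1 0. Proof. by []. Qed.
Lemma pauli2 : pauli R (inord 2) = mx2 0 (- 'i) 'i 0. Proof. by rewrite /pauli inordK. Qed.
Lemma pauli3 : pauli R (inord 3) = mx2 1 0 0 (-1). Proof. by rewrite /pauli inordK. Qed.

Lemma mx2_00 (a b c d : C) : mx2 a b c d 0 0 = a. Proof. by rewrite mxE. Qed.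
Lemma mx2_01 (a b c d : C) : mx2 a b c d 0 1 = b. Proof. by rewrite mxE. Qed.
Lemma mx2_10 (a b c d : C) : mx2 a b c d 1 0 = c. Proof. by rewrite mxE. Qed.
Lemma mx2_11 (a b c d : C) : mx2 a b c d 1 1 = d. Proof. by rewrite mxE. Qed.

Definition mx2E := (mx2_00, mx2_01, mx2_10, mx2_11).

Lemma one2_00 : (1%:M : 'M[C]_2) 0 0 = 1. Proof. by rewrite mxE. Qed.
Lemma one2_01 : (1%:M : 'M[C]_2) 0 1 = 0. Proof. by rewrite mxE. Qed.
Lemma one2_10 : (1%:M : 'M[C]_2) 1 0 = 0. Proof. by rewrite mxE. Qed.
Lemma one2_11 : (1%:M : 'M[C]_2) 1 1 = 1. Proof. by rewrite mxE. Qed.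
Definition one2E := (one2_00, one2_01, one2_10, one2_11).

Definition pauliE := (pauli0, pauli1, pauli2, pauli3).

Lemma sum4_inord (V : nmodType) (F : 'I_4 -> V) :
  \sum_a F a = F 0 + F 1 + F (inord 2) + F (inord 3).
Proof.
rewrite !big_ord_recl big_ord0 addr0 !addrA; congr (_ + F _ + F _ + F _); by apply/val_inj; rewrite /= ?inordK.
Qed.

(** The completeness relation behind both Pauli expansions, [pauli_tens_complete] and
    [pauli_expand]. *)
Lemma pauli_complete (i j k l : 'I_2) :
  \sum_a pauli R a i k * pauli R a l j = 2 * ((i == j) && (k == l))%:R.
Proof.
rewrite sum4_inord !pauliE; move: i j k l.
by do 4! [apply: ord2P]; rewrite !(mx2E, one2E) /=;
  rewrite !(mulr0, mul0r, mulr1, mul1r, addr0, add0r, mulrNN, mulrN, mulNr) -?expr2 ?sqr_i ?opprK ?subrr ?addrN ?addNr //.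
Qed.

Lemma pauli_orth (a b : 'I_4) : \tr (pauli R a *m pauli R b) = 2 * (a == b)%:R.
Proof.
rewrite /mxtrace sum2 !mxE !sum2; move: a b.
by do 2! [apply: ord4P]; rewrite !pauliE !(mx2E, one2E) /= -?val_eqE /= ?inordK //= 
  !(mulr0, mul0r, mulr1, mul1r, addr0, add0r, mulrNN, mulrN, mulNr) -?expr2 ?sqr_i ?opprK ?subrr ?addrN ?addNr //.
Qed.

Lemma trace_tens (A B : 'M[C]_2) : \tr (A *t B) = \tr A * \tr B.
Proof.
rewrite /mxtrace sum_tens big_distrl; apply: eq_bigr => i _ /=.
by rewrite big_distrr; apply: eq_bigr => j _; rewrite tensmxE.
Qed.

Definition bloch (M : 'M[R]_4) : 'M[C]_(2 * 2) :=
  \sum_a \sum_b (4^-1 * M a b)%:C *: (pauli R a *t pauli R b).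

(** Taking real parts makes the correlations real for every [X]; on Hermitian matrices nothing is
    lost. *)
Definition pcorr (X : 'M[C]_(2 * 2)) : 'M[R]_4 :=
  \matrix_(a, b) complex.Re (\tr ((pauli R a *t pauli R b) *m X)).

Lemma pauli_tens_complete (X : 'M[C]_(2 * 2)) :
  X = \sum_a \sum_b (4^-1 * \tr ((pauli R a *t pauli R b) *m X)) *: (pauli R a *t pauli R b).
Proof.
apply/matrixP => r s; case: (mxtens_indexP r) => k l; case: (mxtens_indexP s) => i j.
rewrite summxE.
have E a b : ((4^-1 * \tr ((pauli R a *t pauli R b) *m X)) *: (pauli R a *t pauli R b))
    (mxtens_index (k, l)) (mxtens_index (i, j))
  = \sum_i' \sum_j' \sum_k' \sum_l' 4^-1 * X (mxtens_index (k', l')) (mxtens_index (i', j'))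
     * ((pauli R a i' k' * pauli R a k i) * (pauli R b j' l' * pauli R b l j)).
  rewrite mxE tensmxE /mxtrace sum_tens !mulr_sumr !mulr_suml; apply: eq_bigr => i' _.
  rewrite !mulr_sumr !mulr_suml; apply: eq_bigr => j' _.
  rewrite mxE sum_tens !mulr_sumr !mulr_suml; apply: eq_bigr => k' _.
  rewrite !mulr_sumr !mulr_suml; apply: eq_bigr => l' _.
  by rewrite tensmxE; ring.
under eq_bigr do rewrite summxE.
under eq_bigr do under eq_bigr do rewrite E.
have -> : \sum_a \sum_b \sum_i' \sum_j' \sum_k' \sum_l'
    4^-1 * X (mxtens_index (k', l')) (mxtens_index (i', j'))
     * ((pauli R a i' k' * pauli R a k i) * (pauli R b j' l' * pauli R b l j))
  = \sum_i' \sum_j' \sum_k' \sum_l' 4^-1 * X (mxtens_index (k', l')) (mxtens_index (i', j'))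
     * ((\sum_a pauli R a i' k' * pauli R a k i) * (\sum_b pauli R b j' l' * pauli R b l j)).
  under eq_bigr do rewrite exchange_big /=; rewrite exchange_big /=; apply: eq_bigr => i' _.
  under eq_bigr do rewrite exchange_big /=; rewrite exchange_big /=; apply: eq_bigr => j' _.
  under eq_bigr do rewrite exchange_big /=; rewrite exchange_big /=; apply: eq_bigr => k' _.
  under eq_bigr do rewrite exchange_big /=; rewrite exchange_big /=; apply: eq_bigr => l' _.
  rewrite big_distrl /= mulr_sumr; apply: eq_bigr => a _.
  by rewrite big_distrr /= mulr_sumr.
under eq_bigr do under eq_bigr do under eq_bigr do under eq_bigr do rewrite !pauli_complete.
rewrite (bigD1 i) //= (bigD1 j) //= (bigD1 k) //= (bigD1 l) //= !eqxx /=.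
rewrite !big1 ?addr0; first by field.
- move=> i' /negbTE ni; rewrite big1 // => j' _; rewrite big1 // => k' _; rewrite big1 // => l' _.
  by rewrite ni /= mulr0 mul0r mulr0.
- move=> j' /negbTE nj; rewrite big1 // => k' _; rewrite big1 // => l' _.
  by rewrite nj /= !mulr0.
- by move=> k' /negbTE nk; rewrite big1 // => l' _; rewrite nk /= mulr0 mul0r mulr0.
- by move=> l' /negbTE nl; rewrite nl /= !mulr0.
Qed.

Lemma trace_bloch M a b : \tr ((pauli R a *t pauli R b) *m bloch M) = (M a b)%:C.
Proof.
have trS (I : finType) (F : I -> 'M[C]_(2 * 2)) : \tr (\sum_i F i) = \sum_i \tr (F i) by exact: linear_sum.
have E a' b' : \tr ((pauli R a *t pauli R b) *m ((4^-1 * M a' b')%:C *: (pauli R a' *t pauli R b')))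
   = (M a' b')%:C * ((a == a')%:R * (b == b')%:R).
  rewrite -scalemxAr mxtraceZ tensmx_mul trace_tens !pauli_orth.
  by rewrite rmorphM /= fmorphV /= rmorph_nat; field.
rewrite /bloch mulmx_sumr trS (bigD1 a) //= [X in _ + X]big1 ?addr0 => [|a' /negbTE na].
  rewrite mulmx_sumr trS (bigD1 b) //= [X in _ + X]big1 ?addr0 => [|b' /negbTE nb].
    by rewrite E !eqxx !mulr1.
  by rewrite E [b == _]eq_sym nb !mulr0.
rewrite mulmx_sumr trS big1 // => b' _.
by rewrite E [a == _]eq_sym na mul0r mulr0.
Qed.

Lemma pcorr_bloch M : pcorr (bloch M) = M.
Proof. by apply/matrixP => a b; rewrite mxE trace_bloch. Qed.

Lemma bloch_real (X : 'M[C]_(2 * 2)) (M : 'M[R]_4) :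
  (forall a b, \tr ((pauli R a *t pauli R b) *m X) = (M a b)%:C) -> X = bloch M.
Proof.
move=> h; rewrite [LHS]pauli_tens_complete /bloch; apply: eq_bigr => a _; apply: eq_bigr => b _.
by rewrite h rmorphM /= fmorphV /= rmorph_nat.
Qed.

Lemma ketbraE n (v : 'cV[C]_n) i j : ketbra v i j = v i 0 * Num.conj (v j 0).
Proof. by rewrite /ketbra mxE big_ord1 !mxE. Qed.

(* Correlations [<psi| sigma_a (x) sigma_b |psi>] of
   [psi = p |00> + q |01> + r |10> + s |11>], in real coordinates. *)
Definition corr_table (p1 p2 q1 q2 r1 r2 s1 s2 : R) : seq (seq R) :=
  let: (pp, qq, rr, ss) := (p1^+2 + p2^+2, q1^+2 + q2^+2, r1^+2 + r2^+2, s1^+2 + s2^+2) in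
  let re a1 a2 b1 b2 := 2 * (a1 * b1 + a2 * b2) in
  let im a1 a2 b1 b2 := 2 * (a1 * b2 - a2 * b1) in
  [:: [:: pp + qq + rr + ss; re p1 p2 q1 q2 + re r1 r2 s1 s2;
          im p1 p2 q1 q2 + im r1 r2 s1 s2; pp - qq + rr - ss];
      [:: re p1 p2 r1 r2 + re q1 q2 s1 s2; re p1 p2 s1 s2 + re q1 q2 r1 r2;
          im p1 p2 s1 s2 - im q1 q2 r1 r2; re p1 p2 r1 r2 - re q1 q2 s1 s2];
      [:: im p1 p2 r1 r2 + im q1 q2 s1 s2; im p1 p2 s1 s2 + im q1 q2 r1 r2;
          re q1 q2 r1 r2 - re p1 p2 s1 s2; im p1 p2 r1 r2 - im q1 q2 s1 s2];
      [:: pp + qq - rr - ss; re p1 p2 q1 q2 - re r1 r2 s1 s2;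
          im p1 p2 q1 q2 - im r1 r2 s1 s2; pp - qq - rr + ss]].

Definition ket2 (p q r s : C) : 'cV[C]_(2 * 2) :=
  \col_i (if (mxtens_unindex i).1 == 0 then if (mxtens_unindex i).2 == 0 then p else q
          else if (mxtens_unindex i).2 == 0 then r else s).

Lemma ket2E p q r s : [/\ ket2 p q r s (mxtens_index (0, 0)) 0 = p,
  ket2 p q r s (mxtens_index (0, 1)) 0 = q, ket2 p q r s (mxtens_index (1, 0)) 0 = r
  & ket2 p q r s (mxtens_index (1, 1)) 0 = s].
Proof. by rewrite !mxE !mxtens_indexK. Qed.

Lemma trace_table p1 p2 q1 q2 r1 r2 s1 s2 (a b : 'I_4) :
  \tr ((pauli R a *t pauli R b) *m ketbra (ket2 (p1 +i* p2) (q1 +i* q2) (r1 +i* r2) (s1 +i* s2)))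
  = (nth 0 (nth [::] (corr_table p1 p2 q1 q2 r1 r2 s1 s2) a) b)%:C.
Proof.
set v := ket2 _ _ _ _.
have E i j : ((pauli R a *t pauli R b) *m ketbra v) (mxtens_index (i, j)) (mxtens_index (i, j))
   = \sum_k \sum_l pauli R a i k * pauli R b j l *
     (v (mxtens_index (k, l)) 0 * Num.conj (v (mxtens_index (i, j)) 0)).
  rewrite mxE sum_tens; apply: eq_bigr => k _; apply: eq_bigr => l _.
  by rewrite tensmxE ketbraE.
rewrite /mxtrace sum_tens !sum2 !E !sum2 {E} /v.
have [-> -> -> ->] := ket2E (p1 +i* p2) (q1 +i* q2) (r1 +i* r2) (s1 +i* s2).
rewrite !conjCE; move: a b.
by do 2! [apply: ord4P]; rewrite !pauliE !(mx2E, one2E) /corr_table ?inordK //=;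
  apply/eqP; rewrite eq_complex; apply/andP; split; apply/eqP => /=; ring.
Qed.

End Bloch.

(** * Correlation matrices of pure two-qubit states *)

Section PureStates.
Local Open Scope complex_scope.
Local Open Scope sesquilinear_scope.
Variable R : realType.
Local Notation C := R[i].
Local Notation G := (bdiag (fun=> -1 : R)).

Lemma ket2_eta (v : 'cV[C]_(2 * 2)) : exists p1 p2 q1 q2 r1 r2 s1 s2,
  v = ket2 (p1 +i* p2) (q1 +i* q2) (r1 +i* r2) (s1 +i* s2).
Proof.
pose x i j := v (mxtens_index (i, j)) 0.
have e (z : C) : z = complex.Re z +i* complex.Im z by case: z.
exists (complex.Re (x 0 0)), (complex.Im (x 0 0)), (complex.Re (x 0 1)), (complex.Im (x 0 1)),
  (complex.Re (x 1 0)), (complex.Im (x 1 0)), (complex.Re (x 1 1)), (complex.Im (x 1 1)).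
rewrite -!e; apply/colP => k; case: (mxtens_indexP k) => i j.
have [e1 e2 e3 e4] := ket2E (x 0 0) (x 0 1) (x 1 0) (x 1 1).
by move: i j; do 2! [apply: ord2P]; rewrite ?e1 ?e2 ?e3 ?e4.
Qed.

Lemma pcorr_ket2 (p1 p2 q1 q2 r1 r2 s1 s2 : R) a b :
  pcorr (ketbra (ket2 (p1 +i* p2) (q1 +i* q2) (r1 +i* r2) (s1 +i* s2))) a b
  = nth 0 (nth [::] (corr_table p1 p2 q1 q2 r1 r2 s1 s2) a) b.
Proof. by rewrite mxE trace_table. Qed.

Lemma bloch_ketbra (v : 'cV[C]_(2 * 2)) : ketbra v = bloch (pcorr (ketbra v)).
Proof.
apply: bloch_real => a b; have [p1 [p2 [q1 [q2 [r1 [r2 [s1 [s2 ->]]]]]]]] := ket2_eta v.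
by rewrite pcorr_ket2 trace_table.
Qed.

Lemma metric_entries : [/\ dcoef (fun=> -1) 0 = 1 :> R, dcoef (fun=> -1) 1 = -1 :> R,
  dcoef (fun=> -1) (inord 2) = -1 :> R & dcoef (fun=> -1) (inord 3) = -1 :> R].
Proof.
have h a : a != 0 -> dcoef (fun=> -1) a = -1 :> R.
  by move: a; apply: dcoefP => // i _; rewrite dcoefS.
by split; rewrite ?dcoef0 // h // -val_eqE /= ?inordK.
Qed.

Lemma metricE a b : G a b = (if a == b then if a == 0 then 1 else -1 else 0) :> R.
Proof.
rewrite !mxE; case: eqP => //= _.
by move: a; apply: dcoefP => [|i]; rewrite ?dcoef0 ?dcoefS.
Qed.

Lemma metric_congr (M : 'M[R]_4) a b : (M^T *m G *m M) a b
  = M 0 a * M 0 b - M 1 a * M 1 b - M (inord 2) a * M (inord 2) b - M (inord 3) a * M (inord 3) b.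
Proof.
have [m0 m1 m2 m3] := metric_entries.
by rewrite mxE sum4_inord !mul_mx_bdiag m0 m1 m2 m3 !mxE mulr1 !mulrN1 !mulNr.
Qed.

(** Arranged as a 2 by 2 matrix, the amplitudes have determinant [ps - qr], with real and imaginary
    parts [dr] and [di]. The correlation matrix scales the metric by [4 |ps - qr|^2], so the
    conformal factor [k = 2 |ps - qr|] is the concurrence; it vanishes exactly on product kets. *)
Lemma pure_ketbra (v : 'cV[C]_(2 * 2)) : pure_corr (pcorr (ketbra v)).
Proof.
have [p1 [p2 [q1 [q2 [r1 [r2 [s1 [s2 ->]]]]]]]] := ket2_eta v.
pose dr := p1 * s1 - p2 * s2 - (q1 * r1 - q2 * r2).
pose di := p1 * s2 + p2 * s1 - (q1 * r2 + q2 * r1).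
have k2 : (2 * Num.sqrt (dr ^+ 2 + di ^+ 2)) ^+ 2 = 4 * (dr ^+ 2 + di ^+ 2).
  by rewrite exprMn sqr_sqrtr ?addr_ge0 ?sqr_ge0 //; ring.
set M := pcorr _.
have ME a b : M a b = nth 0 (nth [::] (corr_table p1 p2 q1 q2 r1 r2 s1 s2) a) b.
  exact: pcorr_ket2.
apply: (@conformal_pure _ _ (2 * Num.sqrt (dr ^+ 2 + di ^+ 2))); rewrite ?k2 /dr /di.
- by rewrite mulr_ge0 ?sqrtr_ge0.
- apply/matrixP => a b; rewrite metric_congr [RHS]mxE metricE !ME {M ME k2}; move: a b.
  by do 2! [apply: ord4P]; rewrite /corr_table -?val_eqE /= ?inordK //=; ring.
- rewrite -[X in X *m G](trmxK M).
  have MT a b : M^T a b = M b a by rewrite mxE.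
  apply/matrixP => a b; rewrite metric_congr [RHS]mxE metricE !MT !ME {M ME MT k2}; move: a b.
  by do 2! [apply: ord4P]; rewrite /corr_table -?val_eqE /= ?inordK //=; ring.
- by rewrite ME /= !addr_ge0 // sqr_ge0.
Qed.


Lemma pcorrD (X Y : 'M[C]_(2 * 2)) : pcorr (X + Y) = pcorr X + pcorr Y.
Proof.
by apply/matrixP => a b; rewrite !mxE mulmxDr mxtraceD; case: (\tr _) => ? ?; case: (\tr _).
Qed.

End PureStates.

(** * Positive matrices as sums of rank-one projections *)

Section Positive.
Local Open Scope complex_scope.
Local Open Scope sesquilinear_scope.
Variable R : realType.
Local Notation C := R[i].
Local Notation G := (bdiag (fun=> -1 : R)).

Lemma cdotE n (u v : 'cV[C]_n) : cdot u v = \sum_k Num.conj (u k 0) * v k 0.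
Proof. by rewrite /cdot mxE; apply: eq_bigr => k _; rewrite !mxE. Qed.

Lemma cdotDl n (u u' v : 'cV[C]_n) : cdot (u + u') v = cdot u v + cdot u' v.
Proof. by rewrite !cdotE -big_split; apply: eq_bigr => k _; rewrite mxE rmorphD mulrDl. Qed.

Lemma cdotDr n (u v v' : 'cV[C]_n) : cdot u (v + v') = cdot u v + cdot u v'.
Proof. by rewrite !cdotE -big_split; apply: eq_bigr => k _; rewrite mxE mulrDr. Qed.

Lemma cdotZl n (u v : 'cV[C]_n) c : cdot (c *: u) v = Num.conj c * cdot u v.
Proof. by rewrite !cdotE mulr_sumr; apply: eq_bigr => k _; rewrite mxE rmorphM mulrA. Qed.

Lemma cdotZr n (u v : 'cV[C]_n) c : cdot u (c *: v) = c * cdot u v.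
Proof. by rewrite !cdotE mulr_sumr; apply: eq_bigr => k _; rewrite mxE mulrCA. Qed.

Lemma cdot_delta n i (v : 'cV[C]_n) : cdot (delta_mx i 0) v = v i 0.
Proof.
rewrite cdotE (bigD1 i) //= big1 ?addr0 => [|k /negbTE ki]; rewrite mxE ?eqxx ?ki /=.
  by rewrite rmorph1 mul1r.
by rewrite rmorph0 mul0r.
Qed.

(** Polarization: the form is real on [e_i + e_j] and on [e_i + 'i e_j], which compares the
    imaginary and the real parts of [A i j] and [A j i]. *)
Lemma psd_hermitian n (A : 'M[C]_n) : psd A -> A \is hermsymmx.
Proof.
move=> hA; apply/is_hermitianmxP; rewrite expr0 scale1r.
have form i j (x y : C) : 0 <= Num.conj x * (x * A i i + y * A i j)
     + Num.conj y * (x * A j i + y * A j j).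
  have := hA (x *: delta_mx i 0 + y *: delta_mx j 0).
  rewrite mulmxDr -!scalemxAr cdotDl !cdotZl !cdotDr !cdotZr !cdot_delta.
  by rewrite -!colE !mxE.
have realP (z : C) : 0 <= z -> complex.Im z = 0 by move=> /ger0_Im.
apply/matrixP => i j; rewrite !mxE.
have h0 k : complex.Im (A k k) = 0.
  apply: realP; have := form k k 1 0; rewrite rmorph1 rmorph0 !mul0r !addr0 !mul1r //.
have h1 : complex.Im (A i j) + complex.Im (A j i) = 0.
  have := realP _ (form i j 1 1); rewrite rmorph1 !mul1r; have := h0 i; have := h0 j.
  case: (A i i) (A i j) (A j i) (A j j) => [? ?] [? ?] [? ?] [? ?] /= -> ->.
  by rewrite addr0 add0r.
have h2 : complex.Re (A i j) - complex.Re (A j i) = 0.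
  have := realP _ (form i j 1 'i); rewrite rmorph1 !mul1r; have := h0 i; have := h0 j.
  case: (A i i) (A i j) (A j i) (A j j) => [? ?] [? ?] [? ?] [? ?] /= -> ->.
  by move=> <-; ring.
move: h1 h2; case: (A i j) (A j i) => [a b] [c d] /= h1 h2; rewrite conjCE; congr (_ +i* _); lra.
Qed.

(** The kets are the eigenvectors scaled by the square roots of their eigenvalues. This reduces
    mixed states to pure ones without normalizing them. *)
Lemma psd_ketbras n (A : 'M[C]_n) : psd A -> exists w : 'I_n -> 'cV[C]_n, A = \sum_k ketbra (w k).
Proof.
move=> hA; have hermA := psd_hermitian hA.
have /orthomx_spectralP := hermitian_normalmx hermA.
set P := spectralmx A; set d := spectral_diag A.
have uP : P \is unitarymx by exact: spectral_unitarymx.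
rewrite invmx_unitary // => AE.
have PP : P *m P^t* = 1%:M by apply/unitarymxP.
have d0 k : 0 <= d 0 k.
  have := hA (col k (P^t* )); rewrite /cdot.
  have -> : (col k (P^t* ))^t* = row k P.
    by apply/matrixP => a b; rewrite !mxE conjCK.
  rewrite {1}AE colE !mulmxA -row_mul PP row1 -!mulmxA (mulmxA P) PP mul1mx.
  by rewrite mulmxA -rowE -colE mxE row_diag_mx !mxE !eqxx mulr1.
exists (fun k => sqrtC (d 0 k) *: col k (P^t* )).
rewrite {1}AE; apply/matrixP => i j; rewrite summxE mxE.
apply: eq_bigr => k _; rewrite ketbraE mul_mx_diag !mxE rmorphM /= conjCK.
have -> : Num.conj (sqrtC (d 0 k)) = sqrtC (d 0 k) by apply/CrealP/ger0_real; rewrite sqrtC_ge0.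
by rewrite -{1}(sqrtCK (d 0 k)) expr2; ring.
Qed.

End Positive.

(** * Qubit states as forward vectors *)

Section Qubit.
Local Open Scope complex_scope.
Local Open Scope sesquilinear_scope.
Variable R : realType.
Local Notation C := R[i].
Local Notation G := (bdiag (fun=> -1 : R)).


Lemma minkowski_ge0 (x y : 'cV[R]_4) : fcone x -> fcone y -> 0 <= minkowski x y.
Proof.
move=> hx hy; have := fcone_dot hx hy; rewrite ler_norml => /andP[_].
by rewrite /minkowski subr_ge0.
Qed.

Lemma fconeD (x y : 'cV[R]_4) : fcone x -> fcone y -> fcone (x + y).
Proof.
move=> hx hy; apply/fconeE; have /fconeE[x0 xx] := hx; have /fconeE[y0 yy] := hy.
have xy := minkowski_ge0 hx hy; split; first by rewrite mxE addr_ge0.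
suff -> : minkowski (x + y) (x + y) = minkowski x x + 2 * minkowski x y + minkowski y y.
  by apply: addr_ge0 => //; apply: addr_ge0 => //; apply: mulr_ge0.
by rewrite /minkowski !sum3 !mxE; ring.
Qed.

Definition qvec (A : 'M[C]_2) : 'cV[R]_4 := \col_a complex.Re (\tr (pauli R a *m A)).

Definition qubit_table (p1 p2 q1 q2 : R) : seq R :=
  [:: p1^+2 + p2^+2 + (q1^+2 + q2^+2); 2 * (p1 * q1 + p2 * q2);
      2 * (p1 * q2 - p2 * q1); p1^+2 + p2^+2 - (q1^+2 + q2^+2)].

Lemma qubit_trace (v : 'cV[C]_2) p1 p2 q1 q2 a : v 0 0 = p1 +i* p2 -> v 1 0 = q1 +i* q2 ->
  \tr (pauli R a *m ketbra v) = (nth 0 (qubit_table p1 p2 q1 q2) a)%:C.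
Proof.
move=> e0 e1; rewrite /mxtrace sum2 !mxE !sum2 !ketbraE e0 e1 !conjCE.
move: a; apply: ord4P; rewrite !pauliE !(mx2E, one2E) /qubit_table ?inordK //=;
  by apply/eqP; rewrite eq_complex; apply/andP; split; apply/eqP => /=; ring.
Qed.

Lemma fcone_nth (x : 'cV[R]_4) : 0 <= x 0 0 ->
  x 1 0 ^+ 2 + x (inord 2) 0 ^+ 2 + x (inord 3) 0 ^+ 2 <= x 0 0 ^+ 2 -> fcone x.
Proof.
move=> h0 h; split=> //; move: h; rewrite !big_ord_recl big_ord0 addr0 addrA.
by congr (_ <= _); congr (x _ 0 ^+ 2 + x _ 0 ^+ 2 + x _ 0 ^+ 2); apply/val_inj; rewrite /= ?inordK.
Qed.

(** Both properties are additive, so kets suffice, and the Bloch vector of a ket is light-like. *)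
Lemma psd_qvec (A : 'M[C]_2) : psd A ->
  fcone (qvec A) /\ forall a, \tr (pauli R a *m A) = (qvec A a 0)%:C.
Proof.
move=> /psd_ketbras[w ->]; pose P (A : 'M[C]_2) :=
  fcone (qvec A) /\ forall a, \tr (pauli R a *m A) = (qvec A a 0)%:C.
have PK (v : 'cV[C]_2) : P (ketbra v).
  have ex (z : C) : exists a b, z = a +i* b by case: z => a b; exists a, b.
  have [p1 [p2 ep]] := ex (v 0 0); have [q1 [q2 eq]] := ex (v 1 0).
  have qE a : qvec (ketbra v) a 0 = nth 0 (qubit_table p1 p2 q1 q2) a.
    by rewrite mxE (qubit_trace _ ep eq).
  split; last by move=> a; rewrite (qubit_trace _ ep eq) qE.
  apply: fcone_nth; rewrite !qE /= ?inordK //= ?addr_ge0 ?sqr_ge0 //.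
  by rewrite le_eqVlt; apply/orP; left; apply/eqP; ring.
have PD (X Y : 'M[C]_2) : P X -> P Y -> P (X + Y).
  move=> [hX tX] [hY tY].
  have e : qvec (X + Y) = qvec X + qvec Y.
    apply/colP => a; rewrite !mxE mulmxDr mxtraceD; by case: (\tr _) => ? ?; case: (\tr _).
  rewrite /P e; split; first exact: fconeD.
  by move=> a; rewrite mulmxDr mxtraceD tX tY [(qvec X + qvec Y) _ _]mxE rmorphD.
have P0 : P 0.
  have e : qvec 0 = 0 by apply/colP => a; rewrite !mxE mulmx0 mxtrace0.
  rewrite /P e; split.
    by split; rewrite ?mxE // expr0n big1 // => i _; rewrite mxE expr0n.
  by move=> a; rewrite mulmx0 mxtrace0 mxE rmorph0.
rewrite -/(P _); apply: (big_ind P) => //.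
Qed.

Lemma outerE (x y : 'cV[R]_4) a b : (x *m y^T) a b = x a 0 * y b 0.
Proof. by rewrite mxE big_ord1 mxE. Qed.

Lemma pcorr_tens (A B : 'M[C]_2) : psd A -> psd B -> pcorr (A *t B) = qvec A *m (qvec B)^T.
Proof.
move=> /psd_qvec[_ tA] /psd_qvec[_ tB]; apply/matrixP => a b.
by rewrite outerE [LHS]mxE tensmx_mul trace_tens tA tB -rmorphM.
Qed.

Definition qstate (x : 'cV[R]_4) : 'M[C]_2 := \sum_a (2^-1 * x a 0)%:C *: pauli R a.

Lemma cdotC n (u v : 'cV[C]_n) : cdot v u = Num.conj (cdot u v).
Proof.
rewrite !cdotE rmorph_sum; apply: eq_bigr => k _.
by rewrite rmorphM /= conjCK mulrC.
Qed.

Lemma ketbra_mul n (v u : 'cV[C]_n) : ketbra v *m u = cdot v u *: v.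
Proof. by rewrite /ketbra -mulmxA [v^t* *m u]mx11_scalar mul_mx_scalar. Qed.

Lemma psd_ketbra n (v : 'cV[C]_n) : psd (ketbra v).
Proof. by move=> u; rewrite ketbra_mul cdotZr [cdot u v]cdotC mul_conjC_ge0. Qed.

Lemma cdot_trace n (A : 'M[C]_n) (v : 'cV[C]_n) : cdot v (A *m v) = \tr (A *m ketbra v).
Proof. by rewrite /cdot /ketbra mulmxA mxtrace_mulC !mulmxA /mxtrace big_ord1. Qed.

(** The expectation in a ket is half the Euclidean product of two forward vectors, and such products
    are nonnegative. *)
Lemma qstate_density x : fcone x -> x 0 0 = 1 -> density (qstate x).
Proof.
move=> hx x1; split.
  move=> v; have [hv tv] := psd_qvec (psd_ketbra v).
  have -> : cdot v (qstate x *m v) = (2^-1 * \sum_a x a 0 * qvec (ketbra v) a 0)%:C.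
    rewrite cdot_trace /qstate mulmx_suml linear_sum /= mulr_sumr rmorph_sum; apply: eq_bigr => a _.
    by rewrite -scalemxAl mxtraceZ tv -rmorphM mulrA.
  by rewrite ler0c mulr_ge0 ?invr_ge0 // fcone_dot_ge0.
rewrite /qstate linear_sum /= (bigD1 0) //= big1 ?addr0 => [|a a0].
  by rewrite mxtraceZ mxtrace1 x1 mulr1 fmorphV /= rmorph_nat mulVf // pnatr_eq0.
rewrite mxtraceZ -[pauli R a]mul1mx -pauli0 pauli_orth eq_sym (negbTE a0) mulr0 mulr0 //.
Qed.

Lemma qstate_tens x y : qstate x *t qstate y = bloch (x *m y^T).
Proof.
apply: bloch_real => a b; rewrite tensmx_mul trace_tens.
have h z c : \tr (pauli R c *m qstate z) = (z c 0)%:C.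
  rewrite /qstate mulmx_sumr linear_sum /= (bigD1 c) //= big1 ?addr0 => [|d /negbTE dc].
    by rewrite -scalemxAr mxtraceZ pauli_orth eqxx mulr1 rmorphM /= fmorphV /= rmorph_nat; field.
  by rewrite -scalemxAr mxtraceZ pauli_orth eq_sym dc !mulr0.
by rewrite !h -rmorphM outerE.
Qed.

End Qubit.

(** * Separable states *)

Section Separability.
Local Open Scope complex_scope.
Local Open Scope sesquilinear_scope.
Variable R : realType.
Local Notation C := R[i].
Local Notation G := (bdiag (fun=> -1 : R)).



Lemma blochD (M N : 'M[R]_4) : bloch (M + N) = bloch M + bloch N.
Proof.
rewrite /bloch -big_split; apply: eq_bigr => a _; rewrite -big_split; apply: eq_bigr => b _ /=.
by rewrite mxE mulrDr rmorphD /= scalerDl.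
Qed.

Lemma blochZ c (M : 'M[R]_4) : bloch (c *: M) = c%:C *: bloch M.
Proof.
rewrite /bloch scaler_sumr; apply: eq_bigr => a _; rewrite scaler_sumr; apply: eq_bigr => b _ /=.
by rewrite mxE mulrCA rmorphM scalerA.
Qed.

Lemma bloch0 : bloch (0 : 'M[R]_4) = 0.
Proof. by rewrite -(scale0r 0) blochZ rmorph0 scale0r. Qed.

Lemma bloch_sum (I : finType) (F : I -> 'M[R]_4) : bloch (\sum_i F i) = \sum_i bloch (F i).
Proof. exact: (big_morph (@bloch R) blochD bloch0). Qed.

Lemma pcorrZ c (X : 'M[C]_(2 * 2)) : pcorr (c%:C *: X) = c *: pcorr X.
Proof.
apply/matrixP => a b; rewrite !mxE -scalemxAr mxtraceZ; case: (\tr _) => x y /=.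
by rewrite mul0r subr0.
Qed.

Lemma pcorr_sum (I : finType) (F : I -> 'M[C]_(2 * 2)) : pcorr (\sum_i F i) = \sum_i pcorr (F i).
Proof.
apply: (big_morph (@pcorr R) (@pcorrD R)); apply/matrixP => a b.
by rewrite !mxE mulmx0 mxtrace0.
Qed.

(** A forward vector with zero time component vanishes, so the default [delta_mx 0 0] only ever
    carries weight zero. *)
Definition normalize (x : 'cV[R]_4) : 'cV[R]_4 :=
  if x 0 0 == 0 then delta_mx 0 0 else (x 0 0)^-1 *: x.

Lemma normalize_fcone x : fcone x -> fcone (normalize x).
Proof.
move=> hx; rewrite /normalize; case: ifP => h; first exact: e0_fcone.
by apply: fconeZ => //; rewrite invr_ge0; case: hx.
Qed.

Lemma normalize0 x : normalize x 0 0 = 1.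
Proof.
rewrite /normalize; case: eqP => [_|/eqP h]; first by rewrite mxE.
by rewrite mxE mulVf.
Qed.

Lemma normalizeE x : fcone x -> x = x 0 0 *: normalize x.
Proof.
move=> [_ hx]; rewrite /normalize; case: eqP => [e|/eqP h]; last by rewrite scalerA divff ?scale1r.
rewrite e scale0r; apply/colP; apply: dcoefP => [|i]; rewrite [RHS]mxE //.
apply/eqP; rewrite -sqrf_eq0 eq_le sqr_ge0 andbT; apply: le_trans (_ : x 0 0 ^+ 2 <= 0).
  apply: le_trans hx; rewrite (bigD1 i) //= lerDl sumr_ge0 // => j _; exact: sqr_ge0.
by rewrite e expr0n.
Qed.

(** The product of the two time components becomes the probability, and the normalized vectors
    become the states. *)
Lemma csep_mixture (M : 'M[R]_4) : csep M -> M 0 0 = 1 -> product_mixture (bloch M).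
Proof.
move=> [r [hr ->]]; rewrite (big_nth (0, 0)) big_mkord => M1.
pose x (k : 'I_(size r)) := (nth (0, 0) r k).1; pose y (k : 'I_(size r)) := (nth (0, 0) r k).2.
have hx k : fcone (x k) by have [] := hr _ (mem_nth (0, 0) (ltn_ord k)).
have hy k : fcone (y k) by have [] := hr _ (mem_nth (0, 0) (ltn_ord k)).
exists (size r), (fun k => x k 0 0 * y k 0 0), (fun k => qstate (normalize (x k))),
  (fun k => qstate (normalize (y k))); split.
- by move=> k; rewrite mulr_ge0 //; [case: (hx k) | case: (hy k)].
- by rewrite -[RHS]M1 summxE; apply: eq_bigr => k _; rewrite outerE.
- by move=> k; apply: qstate_density; [exact: normalize_fcone | exact: normalize0].
- by move=> k; apply: qstate_density; [exact: normalize_fcone | exact: normalize0].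
rewrite bloch_sum; apply: eq_bigr => k _; rewrite qstate_tens -blochZ; congr bloch.
rewrite -/(x k) -/(y k) {1}(normalizeE (hx k)) {1}(normalizeE (hy k)) linearZ /=.
by rewrite -scalemxAr -scalemxAl scalerA mulrC.
Qed.

Lemma pauli_le1 (a : 'I_4) i j : `|pauli R a i j| <= 1.
Proof.
have n1 : `|'i : C| = 1 by rewrite normc_def /= expr0n /= add0r expr1n sqrtr1.
move: a i j; apply: ord4P; do 2! [apply: ord2P]; rewrite !pauliE !(mx2E, one2E);
  by rewrite ?normrN ?normr1 ?normr0 ?n1 ?ler01.
Qed.

Lemma approx_separable (M : 'M[R]_4) :
  (forall e, 0 < e -> exists M', [/\ csep M', M' 0 0 = 1 & forall a b, `|M a b - M' a b| <= e]) ->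
  separable (bloch M).
Proof.
move=> h B /nbhs_ballP[e e0 eB].
(* Positivity in [C] makes [e] real. Sixteen terms of size at most [d / 4] add up to [4 * d]. *)
have [d d0 de] : exists2 d : R, 0 < d & (4 * d)%:C < e.
  move: e0; case: e {eB} => u v /=; rewrite ltcE /= => /andP[/eqP -> u0].
  exists (u / 8); first by rewrite divr_gt0.
  by rewrite ltcE /= eqxx /=; lra.
have [M' [sM' M'0 MM']] := h _ d0.
exists (bloch M'); split; first exact: csep_mixture.
apply: eB; split=> // r s.
rewrite /ball /=; apply: le_lt_trans de.
have -> : bloch M r s - bloch M' r s =
    \sum_a \sum_b ((4^-1 * (M a b - M' a b))%:C *: (pauli R a *t pauli R b)) r s.
  rewrite /bloch !summxE -sumrB; apply: eq_bigr => a _.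
  rewrite !summxE -sumrB; apply: eq_bigr => b _.
  by rewrite mulrBr rmorphB scalerBl !mxE.
have E a b : `|((4^-1 * (M a b - M' a b))%:C *: (pauli R a *t pauli R b)) r s| <= (4^-1 * d)%:C.
  rewrite !mxE !normrM -[leRHS]mulr1; apply: ler_pM; rewrite ?mulr_ge0 //.
    by rewrite normc_def /= expr0n addr0 sqrtr_sqr lecR normrM ger0_norm ?invr_ge0 // ler_wpM2l ?invr_ge0.
  by rewrite -[leRHS]mulr1; apply: ler_pM; rewrite ?pauli_le1.
apply: (le_trans (ler_norm_sum _ _ _)).
apply: (@le_trans _ _ (\sum_(a < 4) \sum_(b < 4) (4^-1 * d)%:C)).
  apply: ler_sum => a _; apply: (le_trans (ler_norm_sum _ _ _)); apply: ler_sum => b _; exact: E.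
have e4 : 4^-1 * d *+ 4 *+ 4 = 4 * d by field.
by rewrite !sumr_const !card_ord -!rmorphMn lecR e4.
Qed.

End Separability.

(** * Pauli-diagonal channels *)

Section Channels.
Local Open Scope complex_scope.
Local Open Scope sesquilinear_scope.
Variable R : realType.
Local Notation C := R[i].
Local Notation G := (bdiag (fun=> -1 : R)).




Lemma re_trace_le (P Z : 'M[C]_(2 * 2)) e : (forall r s, `|P r s| <= 1) ->
  (forall r s, `|Z r s| <= e%:C) -> `|complex.Re (\tr (P *m Z))| <= 16 * e.
Proof.
move=> hP hZ; rewrite -lecR; apply: (le_trans (normc_ge_Re _)).
apply: (le_trans (ler_norm_sum _ _ _)).
apply: (@le_trans _ _ (\sum_(r < 2 * 2) \sum_(s < 2 * 2) e%:C)).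
  apply: ler_sum => r _; rewrite mxE; apply: (le_trans (ler_norm_sum _ _ _)); apply: ler_sum => s _.
  by rewrite normrM -[leRHS]mul1r; apply: ler_pM.
have e4 : e *+ (2 * 2) *+ (2 * 2) = 16 * e by ring.
by rewrite !sumr_const !card_ord -!rmorphMn lecR e4.
Qed.

(** An entanglement witness: on a product state the sum is a scalar product of two vectors of the
    unit ball, signs and permutation being isometries. *)
Lemma mixture_functional (X : 'M[C]_(2 * 2)) (p : {perm 'I_3}) (s : 'I_3 -> R) :
  (forall i, s i ^+ 2 = 1) -> product_mixture X ->
  \sum_i s i * pcorr X (lift ord0 i) (lift ord0 (p i)) <= 1.
Proof.
move=> s2 [n [q [rA [rB [q0 q1 dA dB ->]]]]].
pose x k := qvec (rA k); pose y k := qvec (rB k).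
have -> : pcorr (\sum_k (q k)%:C *: (rA k *t rB k)) = \sum_k q k *: (x k *m (y k)^T).
  rewrite pcorr_sum; apply: eq_bigr => k _; rewrite pcorrZ pcorr_tens //; [by case: (dA k) | by case: (dB k)].
have -> : \sum_i s i * (\sum_k q k *: (x k *m (y k)^T)) (lift ord0 i) (lift ord0 (p i))
   = \sum_k q k * \sum_i (s i * x k (lift ord0 i) 0) * y k (lift ord0 (p i)) 0.
  under [RHS]eq_bigr do rewrite mulr_sumr; rewrite exchange_big /=; apply: eq_bigr => i _.
  rewrite summxE mulr_sumr; apply: eq_bigr => k _.
  have -> : (q k *: (x k *m (y k)^T)) (lift ord0 i) (lift ord0 (p i))
     = q k * (x k (lift ord0 i) 0 * y k (lift ord0 (p i)) 0) by rewrite mxE outerE.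
  by ring.
rewrite -[leRHS]q1; apply: ler_sum => k _; rewrite -[leRHS]mulr1 ler_wpM2l //.
have q_one (A : 'M[C]_2) : density A -> fcone (qvec A) /\ qvec A 0 0 = 1.
  move=> [/psd_qvec[hA _] tA]; split=> //.
  by rewrite mxE pauli0 mul1mx tA.
have [hx x1] := q_one _ (dA k); have [hy y1] := q_one _ (dB k).
have h : \sum_i (s i * x k (lift ord0 i) 0) ^+ 2 <= 1 ^+ 2.
  rewrite -x1; case: hx => _; apply: le_trans; rewrite le_eqVlt; apply/orP; left; apply/eqP.
  by apply: eq_bigr => i _; rewrite exprMn s2 mul1r.
have h' : \sum_i (y k (lift ord0 (p i)) 0) ^+ 2 <= 1 ^+ 2.
  rewrite -y1; case: hy => _; apply: le_trans; rewrite le_eqVlt; apply/orP; left; apply/eqP.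
  by rewrite [RHS](reindex_inj (@perm_inj _ p)).
have := cauchy_le ler01 ler01 h h'; rewrite mulr1; apply: le_trans; exact: ler_norm.
Qed.

Lemma separable_functional (X : 'M[C]_(2 * 2)) (p : {perm 'I_3}) (s : 'I_3 -> R) :
  (forall i, s i ^+ 2 = 1) -> separable X ->
  \sum_i s i * pcorr X (lift ord0 i) (lift ord0 (p i)) <= 1.
Proof.
move=> s2 sX; rewrite leNgt; apply/negP; set v := \sum_i _ => v1.
(* Three correlations each move by at most [16 * e], in total half of [v - 1]. *)
pose e := (v - 1) / 96.
have e0 : 0 < e by rewrite divr_gt0 // subr_gt0.
have e0' : 0 < e%:C by rewrite ltcR.
have [Y [mY XY]] := sX _ (@nbhsx_ballx _ 'M[(C : numFieldType)]_(2 * 2) X _ e0').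
have XY' r q : `|(X - Y) r q| <= e%:C.
  by case: XY => _ /(_ r q); rewrite /ball /= !mxE => /ltW.
have close a b : pcorr X a b <= pcorr Y a b + 16 * e /\ pcorr Y a b <= pcorr X a b + 16 * e.
  have P1 r q : `|(pauli R a *t pauli R b) r q| <= 1.
    by rewrite mxE normrM -[leRHS]mulr1; apply: ler_pM; rewrite ?pauli_le1.
  have := re_trace_le P1 XY'; rewrite mulmxBr linearB /= raddfB /= -/(\tr _).
  have -> : complex.Re (\tr ((pauli R a *t pauli R b) *m X)) = pcorr X a b by rewrite mxE.
  have -> : complex.Re (\tr ((pauli R a *t pauli R b) *m Y)) = pcorr Y a b by rewrite mxE.
  by rewrite ler_norml => /andP[h1 h2]; split; lra.
have := mixture_functional p s2 mY.
suff : v <= \sum_i s i * pcorr Y (lift ord0 i) (lift ord0 (p i)) + 3 * (16 * e).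
  rewrite /e; lra.
rewrite /v -lerBlDl -sumrB; apply: sum3_le => i.
have [h1 h2] := close (lift ord0 i) (lift ord0 (p i)).
have /eqP : s i ^+ 2 = 1 by []. rewrite sqrf_eq1 => /orP[]/eqP ->; lra.
Qed.

Section Tensmap.
Variables F H : {linear 'M[C]_2 -> 'M[C]_2}.

Lemma tensmapD X Y : tensmap F H (X + Y) = tensmap F H X + tensmap F H Y.
Proof.
rewrite /tensmap; do 4! [rewrite -big_split; apply: eq_bigr => ? _ /=].
by rewrite mxE scalerDl.
Qed.

Lemma tensmapZ c X : tensmap F H (c *: X) = c *: tensmap F H X.
Proof.
rewrite /tensmap; do 4! [rewrite scaler_sumr; apply: eq_bigr => ? _ /=].
by rewrite mxE scalerA.
Qed.

Lemma tensmap_sum (I : finType) (X : I -> 'M[C]_(2 * 2)) :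
  tensmap F H (\sum_i X i) = \sum_i tensmap F H (X i).
Proof.
apply: (big_morph (tensmap F H) tensmapD).
by rewrite -[X in tensmap F H X](scale0r 0) tensmapZ scale0r.
Qed.

Lemma tensmap_bloch l m (M : 'M[R]_4) :
  (forall a, F (pauli R a) = (dcoef l a)%:C *: pauli R a) ->
  (forall a, H (pauli R a) = (dcoef m a)%:C *: pauli R a) ->
  tensmap F H (bloch M) = bloch (bdiag l *m M *m bdiag m).
Proof.
move=> hF hH; rewrite /bloch tensmap_sum; apply: eq_bigr => a _.
rewrite tensmap_sum; apply: eq_bigr => b _; rewrite tensmapZ tensmap_tens hF hH.
have -> : ((dcoef l a)%:C *: pauli R a) *t ((dcoef m b)%:C *: pauli R b)
   = ((dcoef l a)%:C * (dcoef m b)%:C) *: (pauli R a *t pauli R b).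
  by apply/matrixP => r s; rewrite !mxE; ring.
rewrite scalerA mul_mx_bdiag mul_bdiag; congr (_ *: _).
by rewrite -!rmorphM; congr (_%:C); ring.
Qed.

End Tensmap.

Lemma adj_tens m n p q (A : 'M[C]_(m, n)) (B : 'M[C]_(p, q)) : (A *t B)^t* = A^t* *t B^t*.
Proof. by rewrite trmx_tens map_mxT. Qed.

(** Complete positivity with a one-dimensional ancilla, the tensor factor [one] carrying the qubit
    to dimension [1 * 2]. *)
Lemma cp_psd (F : {linear 'M[C]_2 -> 'M[C]_2}) (v : 'cV[C]_2) :
  completely_positive F -> psd (F (ketbra v)).
Proof.
move=> cpF u; pose one : 'M[C]_1 := 1%:M.
have o1 : one^t* = one by apply/matrixP => i j; rewrite !ord1 !mxE rmorph1.
have adj1 (w : 'cV[C]_2) : (one *t w : 'cV[C]_(1 * 2))^t* = one *t w^t* :> 'M[C]_(1, 1 * 2).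
  by rewrite -[X in X *t w^t*]o1; exact: (@adj_tens 1 1 2 1 one w).
have mul1 (p q r : nat) (A : 'M[C]_(p, q)) (B : 'M[C]_(q, r)) : (one *t A) *m (one *t B) = one *t (A *m B).
  by rewrite tensmx_mul mul1mx.
have hX : psd (one *t ketbra v).
  have -> : one *t ketbra v = ketbra (one *t v : 'cV[C]_(1 * 2)).
    by rewrite /ketbra adj1; exact: (esym (mul1 2 1 2 v (v^t* ))).
  exact: psd_ketbra.
have := cpF 1%N _ hX (one *t u : 'cV[C]_(1 * 2)).
have -> : tensmap (@id 'M[C]_1) F (one *t ketbra v) = one *t F (ketbra v).
  exact: (@tensmap_tens R 1 1 2 2 idfun F).
have -> : (one *t F (ketbra v)) *m (one *t u : 'cV[C]_(1 * 2)) = one *t (F (ketbra v) *m u) :> 'cV[C]_(1 * 2).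
  exact: (mul1 2 2 1 _ u).
rewrite /cdot adj1.
have -> : (one *t u^t* ) *m (one *t (F (ketbra v) *m u) : 'cV[C]_(1 * 2))
    = one *t (u^t* *m (F (ketbra v) *m u)) :> 'M[C]_1.
  exact: (mul1 1 2 1 (u^t* ) _).
by rewrite mxE /one mxE eqxx mul1r !(ord1 (mxtens_unindex _).2).
Qed.

Lemma fcone_entry (x : 'cV[R]_4) a : fcone x -> `|x a 0| <= x 0 0.
Proof.
move=> [x0 hx]; move: a; apply: dcoefP => [|i]; first by rewrite ger0_norm.
apply: ler_norm_sqr => //; apply: le_trans hx.
by rewrite (bigD1 i) //= lerDl sumr_ge0 // => j _; exact: sqr_ge0.
Qed.

Definition hsqrt : R := (Num.sqrt 2)^-1.

Lemma hsqrt2 : hsqrt * hsqrt = 2^-1.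
Proof. by rewrite -expr2 exprVn sqr_sqrtr. Qed.

Lemma hsqrt2C : hsqrt%:C * hsqrt%:C = 2^-1 :> C.
Proof. by rewrite -rmorphM hsqrt2 fmorphV /= rmorph_nat. Qed.

Definition ket1 (a b : C) : 'cV[C]_2 := \col_i (if i == 0 then a else b).

Lemma ket1_0 a b : ket1 a b 0 0 = a. Proof. by rewrite mxE. Qed.
Lemma ket1_1 a b : ket1 a b 1 0 = b. Proof. by rewrite mxE. Qed.

(** The kets are eigenvectors for the eigenvalue 1; [pauli_channel] probes the channel on them. *)
Lemma pauli_projector (a : 'I_4) : a != 0 -> exists v, ketbra v = 2^-1 *: (1%:M + pauli R a).
Proof.
have cr : Num.conj (hsqrt%:C) = hsqrt%:C :> C by rewrite conjCE oppr0.
have ci : Num.conj ('i : C) = - 'i by rewrite conjCE; congr (_ +i* _); rewrite oppr0.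
have i2 : 'i * 'i = -1 :> C by rewrite -expr2 sqr_i.
have E (A : 'M[C]_2) i j : (2^-1 *: (1%:M + A)) i j = 2^-1 * ((1%:M : 'M[C]_2) i j + A i j) by rewrite !mxE.
move: a; apply: ord4P => // _; [exists (ket1 hsqrt%:C hsqrt%:C)
  | exists (ket1 hsqrt%:C (hsqrt%:C * 'i)) | exists (ket1 1 0)];
  apply/matrixP; do 2! [apply: ord2P]; rewrite ketbraE E ?ket1_0 ?ket1_1
   !pauliE !(mx2E, one2E) ?rmorphM /= ?cr ?ci ?rmorph0 ?rmorph1.
1-5: by rewrite hsqrt2C ?add0r ?addr0 mulr1.
- by rewrite mulrA hsqrt2C add0r.
- by rewrite mulrAC hsqrt2C add0r.
- by rewrite mulrACA hsqrt2C mulrN i2 opprK addr0.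
all: by field.
Qed.

Lemma pauli_expand (Y : 'M[C]_2) : Y = \sum_a (2^-1 * \tr (pauli R a *m Y)) *: pauli R a.
Proof.
apply/matrixP => k l; rewrite summxE.
have E a : ((2^-1 * \tr (pauli R a *m Y)) *: pauli R a) k l
   = \sum_i \sum_j 2^-1 * Y j i * (pauli R a i j * pauli R a k l).
  rewrite mxE /mxtrace !mulr_sumr !mulr_suml; apply: eq_bigr => i _.
  by rewrite mxE !mulr_sumr !mulr_suml; apply: eq_bigr => j _; ring.
under eq_bigr do rewrite E.
rewrite exchange_big /= (bigD1 l) //= [X in _ + X]big1 ?addr0 => [|i /negbTE il].
  rewrite exchange_big /= (bigD1 k) //= [X in _ + X]big1 ?addr0 => [|j /negbTE jk].
    by rewrite -mulr_sumr pauli_complete !eqxx /=; field.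
  by rewrite -mulr_sumr pauli_complete jk andbF !mulr0.
rewrite exchange_big big1 // => j _.
by rewrite -mulr_sumr pauli_complete il !mulr0.
Qed.

(** The image of the projector [(1 + sigma_a) / 2] is positive of trace 1, and its Bloch component
    along [a] is the diagonal entry, which is therefore real and at most 1 in absolute value. *)
Lemma pauli_channel (F : {linear 'M[C]_2 -> 'M[C]_2}) :
  unital_channel F -> is_diag_mx (pauli_rep F) ->
  exists l : 'I_3 -> R, (forall i, `|l i| <= 1) /\
    forall a, F (pauli R a) = (dcoef l a)%:C *: pauli R a.
Proof.
move=> [cpF tpF uF] /is_diag_mxP dF.
have FE a : F (pauli R a) = pauli_rep F a a *: pauli R a.
  rewrite [LHS]pauli_expand (bigD1 a) //= big1 ?addr0 => [|b ba]; first by rewrite mxE.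
  have -> : 2^-1 * \tr (pauli R b *m F (pauli R a)) = pauli_rep F b a by rewrite mxE.
  by rewrite dF ?scale0r.
have real a : a != 0 -> exists x : R, `|x| <= 1 /\ pauli_rep F a a = x%:C.
  move=> a0; have [v vE] := pauli_projector a0.
  have [hx tx] := psd_qvec (cp_psd v cpF).
  exists (qvec (F (ketbra v)) a 0); split.
    apply: le_trans (fcone_entry a hx) _.
    rewrite mxE pauli0 mul1mx tpF vE mxtraceZ mxtraceD mxtrace1.
    have := pauli_orth R 0 a; rewrite pauli0 mul1mx eq_sym (negbTE a0) mulr0 => ->.
    by rewrite addr0 mulVf ?pnatr_eq0.
  rewrite -tx vE linearZ linearD /= uF FE -scalemxAr mxtraceZ mulmxDr mxtraceD mulmx1.
  have := pauli_orth R 0 a; rewrite pauli0 mul1mx eq_sym (negbTE a0) mulr0 => ->.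
  by rewrite add0r -scalemxAr mxtraceZ pauli_orth eqxx mulr1; field.
have /fin_all_exists[l hl] (i : 'I_3) := real (lift ord0 i) isT.
exists l; split=> [i|]; first by have [] := hl i.
apply: dcoefP => [|i]; first by rewrite dcoef0 pauli0 uF scale1r.
by rewrite dcoefS FE; have [_ ->] := hl i.
Qed.

End Channels.

(** * The six maximally entangled states *)

Section Robustness.
Local Open Scope complex_scope.
Local Open Scope sesquilinear_scope.
Variable R : realType.
Local Notation C := R[i].
Local Notation G := (bdiag (fun=> -1 : R)).





Definition bell (x y : 'cV[C]_2) := max_entangled_ket (ket1 1 0) (ket1 0 1) x y.

Lemma sqrtC2V : (sqrtC 2)^-1 = (hsqrt R)%:C :> C.
Proof.
rewrite fmorphV /=; congr (_^-1); apply/eqP.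
rewrite -(@eqrXn2 _ 2) ?sqrtC_ge0 ?ler0n ?ler0c ?sqrtr_ge0 // sqrtCK -rmorphXn /= sqr_sqrtr //.
by rewrite rmorph_nat.
Qed.

Lemma bellE (x y : 'cV[C]_2) : bell x y =
  ket2 ((hsqrt R)%:C * x 0 0) ((hsqrt R)%:C * x 1 0) ((hsqrt R)%:C * y 0 0) ((hsqrt R)%:C * y 1 0).
Proof.
have tE (u v : 'cV[C]_2) i j : (u *t v : 'cV[C]_(2 * 2)) (mxtens_index (i, j)) 0 = u i 0 * v j 0.
  by rewrite mxE mxtens_indexK; congr (u _ _ * v _ _); apply/val_inj.
have E i j : bell x y (mxtens_index (i, j)) 0
    = (hsqrt R)%:C * (ket1 1 0 i 0 * x j 0 + ket1 0 1 i 0 * y j 0).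
  rewrite /bell /max_entangled_ket sqrtC2V -!tE mxE; congr (_ * _).
  by rewrite [LHS]mxE.
apply/colP => k; case: (mxtens_indexP k) => i j; rewrite E.
set p := _ * x 0 0; set q := _ * x 1 0; set r := _ * y 0 0; set s := _ * y 1 0.
have [e1 e2 e3 e4] := ket2E p q r s.
by move: i j; do 2! [apply: ord2P]; rewrite ?e1 ?e2 ?e3 ?e4 ?ket1_0 ?ket1_1 ?mul1r ?mul0r ?addr0 ?add0r.
Qed.

Lemma cdot2 (u v : 'cV[C]_2) : cdot u v = Num.conj (u 0 0) * v 0 0 + Num.conj (u 1 0) * v 1 0.
Proof. by rewrite cdotE sum2. Qed.

Lemma mul2E (A : 'M[C]_2) a b : A *m ket1 a b = ket1 (A 0 0 * a + A 0 1 * b) (A 1 0 * a + A 1 1 * b).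
Proof. by apply/colP; apply: ord2P; rewrite mxE sum2 !ket1_0 !ket1_1. Qed.

Lemma scale_ket1 c a b : c *: ket1 a b = ket1 (c * a) (c * b) :> 'cV[C]_2.
Proof. by apply/colP; apply: ord2P; rewrite !mxE. Qed.

(** With phase ['i] on the second vector only, the Bell state changes its relative phase: up to
    sign, the correlations of [sigma_1] and [sigma_2] on the first qubit are exchanged. *)
Lemma eigenbasis_phase k (u v : 'cV[C]_2) th : Num.conj th * th = 1 ->
  pauli_eigenbasis k u v -> pauli_eigenbasis k u (th *: v).
Proof.
move=> th1 [u1 v1 uv eu [b ev]]; split=> //.
- by rewrite cdotZl cdotZr v1 mulr1.
- by rewrite cdotZr uv mulr0.
by exists b; rewrite -scalemxAr ev !scalerA mulrC.
Qed.

Let h : C := (hsqrt R)%:C.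

Lemma conj_h : Num.conj h = h. Proof. by rewrite /h conjCE oppr0. Qed.
Lemma conj_i : Num.conj ('i : C) = - 'i. Proof. by rewrite conjCE; congr (_ +i* _); rewrite oppr0. Qed.
Lemma hh : h * h = 2^-1. Proof. exact: hsqrt2C. Qed.
Lemma ii : 'i * 'i = -1 :> C. Proof. by rewrite -expr2 sqr_i. Qed.

Lemma eigenbasis3 : pauli_eigenbasis (inord 3) (ket1 1 0) (ket1 0 1 : 'cV[C]_2).
Proof.
split; rewrite ?cdot2 ?ket1_0 ?ket1_1 ?rmorph0 ?rmorph1 ?(mulr0, mul0r, mulr1, addr0, add0r) //.
- by exists 1; rewrite mul2E pauli3 !mx2E scale_ket1; congr ket1; ring.
- by exists (-1); rewrite mul2E pauli3 !mx2E scale_ket1; congr ket1; ring.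
Qed.

Lemma eigenbasis1 : pauli_eigenbasis 1 (ket1 h h) (ket1 h (- h)).
Proof.
split; rewrite ?cdot2 ?ket1_0 ?ket1_1 ?rmorphN /= ?conj_h ?mulrNN ?mulrN ?hh ?subrr //; try by field.
- by exists 1; rewrite mul2E pauli1 !mx2E scale_ket1; congr ket1; ring.
- by exists (-1); rewrite mul2E pauli1 !mx2E scale_ket1; congr ket1; ring.
Qed.

Lemma eigenbasis2 : pauli_eigenbasis (inord 2) (ket1 h (h * 'i)) (ket1 h (- (h * 'i))).
Proof.
have e : h * 'i * (h * 'i) = - 2^-1 by rewrite mulrACA hh ii mulrN1.
split; rewrite ?cdot2 ?ket1_0 ?ket1_1 ?rmorphN ?rmorphM /= ?conj_h ?conj_i
  ?mulrN ?mulNr ?opprK ?e ?hh ?opprK ?subrr //; try by field.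
- exists 1; rewrite mul2E pauli2 !mx2E scale_ket1; congr ket1; rewrite ?mulNr.
    by rewrite mul0r add0r mulrCA ii mulrN1 opprK mul1r.
  by rewrite mul0r addr0 mul1r mulrC.
- exists (-1); rewrite mul2E pauli2 !mx2E scale_ket1; congr ket1; rewrite ?mulNr.
    by rewrite mul0r add0r mulrN opprK mulrCA ii mulrN1 mul1r.
  by rewrite mul0r addr0 mulrN opprK mul1r mulrC.
Qed.


Lemma ord3P (P : 'I_3 -> Prop) : P 0 -> P 1 -> P (inord 2) -> forall i, P i.
Proof.
move=> P0 P1 P2 [[|[|[|//]]] lt].
- by rewrite (_ : Ordinal lt = 0) //; apply/val_inj.
- by rewrite (_ : Ordinal lt = 1) //; apply/val_inj.
- by rewrite (_ : Ordinal lt = inord 2) //; apply/val_inj; rewrite /= inordK.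
Qed.

(** [P] ranges over natural numbers so that in each case the entries of [corr_table] compute. *)
Lemma perm3P (p : {perm 'I_3}) (P : nat -> nat -> nat -> Prop) :
  P 0 1 2 -> P 0 2 1 -> P 1 0 2 -> P 1 2 0 -> P 2 0 1 -> P 2 1 0 ->
  P (p 0) (p 1) (p (inord 2)).
Proof.
have n01 : p 0 != p 1 :> nat by rewrite val_eqE (inj_eq perm_inj).
have n02 : p 0 != p (inord 2) :> nat by rewrite val_eqE (inj_eq perm_inj) -val_eqE /= inordK.
have n12 : p 1 != p (inord 2) :> nat by rewrite val_eqE (inj_eq perm_inj) -val_eqE /= inordK.
move: (ltn_ord (p 0)) (ltn_ord (p 1)) (ltn_ord (p (inord 2))) n01 n02 n12.
move: (p 0 : nat) (p 1 : nat) (p (inord 2) : nat).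
by move=> [|[|[|//]]] [|[|[|//]]] [|[|[|//]]].
Qed.

Lemma pauli00 : pauli R 0 *t pauli R 0 = 1%:M.
Proof.
apply/matrixP => r s; case: (mxtens_indexP r) => i j; case: (mxtens_indexP s) => k l.
rewrite tensmxE !mxE (can_eq (@mxtens_indexK 2 2)) xpair_eqE.
by case: eqP; case: eqP; rewrite ?mulr1 ?mulr0 ?mul0r.
Qed.

(* The state [X] tests the inequality of [csep_generic] for the permutation [p]. *)
Definition detects (X : 'M[C]_(2 * 2)) (p : {perm 'I_3}) :=
  \tr X = 1 /\ forall i, pcorr X (lift ord0 i) (lift ord0 (p i)) ^+ 2 = 1.

Lemma detects_table p1 p2 q1 q2 r1 r2 s1 s2 (p : {perm 'I_3}) :
  let T := corr_table p1 p2 q1 q2 r1 r2 s1 s2 in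
  nth 0 (nth [::] T 0) 0 = 1 ->
  nth 0 (nth [::] T 1) (p 0).+1 ^+ 2 = 1 -> nth 0 (nth [::] T 2) (p 1).+1 ^+ 2 = 1 ->
  nth 0 (nth [::] T 3) (p (inord 2)).+1 ^+ 2 = 1 ->
  detects (ketbra (ket2 (p1 +i* p2) (q1 +i* q2) (r1 +i* r2) (s1 +i* s2))) p.
Proof.
move=> T t0 t1 t2 t3; split.
  have := trace_table p1 p2 q1 q2 r1 r2 s1 s2 0 0.
  by rewrite pauli00 mul1mx => ->; rewrite t0.
by apply: ord3P; rewrite pcorr_ket2 !lift0 // inordK.
Qed.

Lemma half_h : h * h = (2^-1 : R) +i* 0.
Proof. by rewrite hh -[RHS]/((2^-1 : R)%:C) fmorphV /= rmorph_nat. Qed.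

Lemma phase_i : Num.conj 'i * 'i = 1 :> C.
Proof. by rewrite conj_i mulNr ii opprK. Qed.

(** The first qubit always uses the [sigma_3] basis. The basis of the second qubit selects the Pauli
    operator paired with [sigma_3], and the phase [1] or ['i] selects one of the two remaining
    pairings: three bases and two phases give the six permutations. *)
Lemma detecting_bell (p : {perm 'I_3}) : exists k x y,
  [/\ k != ord0, pauli_eigenbasis k x y & detects (ketbra (bell x y)) p].
Proof.
have n3 : inord 3 != ord0 :> 'I_4 by rewrite -val_eqE /= inordK.
have n2 : inord 2 != ord0 :> 'I_4 by rewrite -val_eqE /= inordK.
have n1 : 1 != ord0 :> 'I_4 by [].
have mi (a b : R) : (a +i* b) * 'i = (- b) +i* a :> C.
  by apply/eqP; rewrite eq_complex /=; apply/andP; split; apply/eqP; ring.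
have h2 : hsqrt R * hsqrt R = 2^-1 by exact: hsqrt2.
have z1 : h = (hsqrt R) +i* 0 by [].
have oppE (a b : R) : - (a +i* b) = (- a) +i* (- b) :> C by [].
have v1 : h * (h * 'i) = 0 +i* 2^-1 by rewrite mulrA half_h mi oppr0.
have v2 : h * - h = (- 2^-1) +i* 0 by rewrite mulrN half_h oppE oppr0.
have v3 : h * - (h * 'i) = 0 +i* (- 2^-1) by rewrite mulrN v1 oppE oppr0.
have v4 : h * ('i * h) = 0 +i* 2^-1 by rewrite ['i * h]mulrC.
have v5 : h * ('i * - h) = 0 +i* (- 2^-1) by rewrite mulrN mulrN v4 oppE oppr0.
have v6 : h * ('i * - (h * 'i)) = 2^-1 +i* 0.
  by rewrite mulrN mulrN ['i * _]mulrCA ii mulrN1 mulrN opprK half_h.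
have v7 : h * ('i * 1) = 0 +i* hsqrt R by rewrite mulr1 z1 mi oppr0.
pose T_ok (p1 p2 q1 q2 r1 r2 s1 s2 : R) (a b c : nat) :=
  let T := corr_table p1 p2 q1 q2 r1 r2 s1 s2 in
  [/\ nth 0 (nth [::] T 0) 0 = 1, nth 0 (nth [::] T 1) a.+1 ^+ 2 = 1,
    nth 0 (nth [::] T 2) b.+1 ^+ 2 = 1 & nth 0 (nth [::] T 3) c.+1 ^+ 2 = 1].
pose Gp := exists k x y, [/\ k != ord0, pauli_eigenbasis k x y & detects (ketbra (bell x y)) p].
(* Continuation form: each case only has to hand its basis and its eight real amplitudes to
   [main]. *)
pose P a b c := (forall k x y p1 p2 q1 q2 r1 r2 s1 s2, T_ok p1 p2 q1 q2 r1 r2 s1 s2 a b c ->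
    k != ord0 -> pauli_eigenbasis k x y ->
    h * x 0 0 = p1 +i* p2 -> h * x 1 0 = q1 +i* q2 -> h * y 0 0 = r1 +i* r2 -> h * y 1 0 = s1 +i* s2 ->
    Gp) -> Gp.
suff : P (p 0) (p 1) (p (inord 2)).
  apply=> k x y p1 p2 q1 q2 r1 r2 s1 s2 [t0 t1 t2 t3] k0 e ep eq er es; exists k, x, y; split=> //.
  by rewrite bellE -/h ep eq er es; apply: detects_table.
have eig3i := eigenbasis_phase phase_i eigenbasis3.
have eig1i := eigenbasis_phase phase_i eigenbasis1.
have eig2i := eigenbasis_phase phase_i eigenbasis2.
pose t := hsqrt R.
have tt : (2 * (t * t)) = 1 by rewrite h2 mulfV.
have sE (c : C) (v : 'cV[C]_2) i : (c *: v) i 0 = c * v i 0 by rewrite mxE.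
apply: (@perm3P p P); rewrite /P => main.
- apply: (main _ _ _ t 0 0 0 0 0 t 0 _ n3 eigenbasis3); rewrite ?ket1_0 ?ket1_1 ?mulr1 ?mulr0 //.
  rewrite /T_ok /=; split; [transitivity (2 * (t * t)) | transitivity ((2 * (t * t)) ^+ 2)..];
    by [ring | rewrite tt ?expr1n].
- apply: (main _ _ _ 2^-1 0 0 2^-1 0 2^-1 2^-1 0 _ n2 eig2i); rewrite ?sE ?ket1_0 ?ket1_1 ?half_h //.
  by rewrite /T_ok /=; split; field.
- apply: (main _ _ _ t 0 0 0 0 0 0 t _ n3 eig3i); rewrite ?sE ?ket1_0 ?ket1_1 ?v7 ?mulr1 ?mulr0 //.
  rewrite /T_ok /=; split; [transitivity (2 * (t * t)) | transitivity ((2 * (t * t)) ^+ 2)..];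
    by [ring | rewrite tt ?expr1n].
- apply: (main _ _ _ 2^-1 0 2^-1 0 0 2^-1 0 (- 2^-1) _ n1 eig1i); rewrite ?sE ?ket1_0 ?ket1_1 ?half_h //.
  by rewrite /T_ok /=; split; field.
- apply: (main _ _ _ 2^-1 0 0 2^-1 2^-1 0 0 (- 2^-1) _ n2 eigenbasis2); rewrite ?ket1_0 ?ket1_1 ?half_h //.
  by rewrite /T_ok /=; split; field.
- apply: (main _ _ _ 2^-1 0 2^-1 0 2^-1 0 (- 2^-1) 0 _ n1 eigenbasis1); rewrite ?ket1_0 ?ket1_1 ?half_h //.
  by rewrite /T_ok /=; split; field.
Qed.

Lemma sqr1_norm (x : R) : x ^+ 2 = 1 -> `|x| = 1.
Proof. by move=> /eqP; rewrite sqrf_eq1 => /orP[]/eqP ->; rewrite ?normrN normr1. Qed.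

(** The six inequalities extracted from the test states no longer mention any state, so they apply
    to every input, decomposed into kets. *)
Lemma separable_all (F H : {linear 'M[C]_2 -> 'M[C]_2}) (X : {perm 'I_3} -> 'M[C]_(2 * 2)) :
  unital_channel F -> is_diag_mx (pauli_rep F) -> unital_channel H -> is_diag_mx (pauli_rep H) ->
  (forall p, detects (X p) p) -> (forall p, exists v, X p = ketbra v) ->
  (forall p, separable (tensmap F H (X p))) ->
  forall rho, density rho -> separable (tensmap F H rho).
Proof.
move=> uF dF uH dH hX pureX sepX rho [/psd_ketbras[w wE] tr1].
have [l [l1 FE]] := pauli_channel uF dF; have [m [m1 HE]] := pauli_channel uH dH.
have lm (p : {perm 'I_3}) : \sum_i `|l i| * `|m (p i)| <= 1.
  have [v vE] := pureX p; have [_ hp] := hX p.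
  have XE : tensmap F H (X p) = bloch (bdiag l *m pcorr (X p) *m bdiag m).
    by rewrite {1}vE bloch_ketbra -vE; apply: tensmap_bloch.
  pose M := bdiag l *m pcorr (X p) *m bdiag m.
  have ME i : `|M (lift ord0 i) (lift ord0 (p i))| = `|l i| * `|m (p i)|.
    by rewrite /M mul_mx_bdiag mul_bdiag !dcoefS !normrM (sqr1_norm (hp i)) mulr1.
  (* The witness with the signs of the output correlations returns the sum of their absolute
     values. *)
  have [s [s2 sM]] := bdiag_abs (fun i => M (lift ord0 i) (lift ord0 (p i))).
  have := separable_functional p s2 (sepX p); rewrite XE pcorr_bloch; apply: le_trans.
  rewrite le_eqVlt; apply/orP; left; apply/eqP; apply: eq_bigr => i _.
  by rewrite -ME -/M [in RHS]sM mulrA -expr2 s2 mul1r.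
have rhoE : rho = bloch (\sum_k pcorr (ketbra (w k))).
  by rewrite wE bloch_sum; apply: eq_bigr => k _; exact: bloch_ketbra.
have r00 : (\sum_k pcorr (ketbra (w k))) 0 0 = 1.
  have := trace_bloch (\sum_k pcorr (ketbra (w k))) 0 0.
  by rewrite -rhoE pauli00 mul1mx tr1 => /(congr1 (@complex.Re R)).
rewrite rhoE (tensmap_bloch _ FE HE); apply: approx_separable => e e0.
have pk k : pure_corr (pcorr (ketbra (w k))) by exact: pure_ketbra.
have [M' [sM' M'0 MM']] := csep_approx pk l1 m1 lm e0.
exists M'; split=> //.
by rewrite M'0 mul_mx_bdiag mul_bdiag !dcoef0 mul1r mulr1.
Qed.

End Robustness.

Lemma exists_argmax d (T : orderType d) (I : finType) (i0 : I) (f : I -> T) :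
  exists i, forall j, (f j <= f i)%O.
Proof.
suff [i hi] : exists i, {in enum I, forall j, (f j <= f i)%O}.
  by exists i => j; apply: hi; rewrite mem_enum.
elim: (enum I) => [|k s [i hi]]; first by exists i0.
case: (leP (f k) (f i)) => [ki|/ltW ik].
  by exists i => j; rewrite inE => /orP[/eqP ->|/hi].
by exists k => j; rewrite inE => /orP[/eqP ->|/hi/le_trans->].
Qed.

Theorem proposition2 (R : realType)
    (U U' : R -> {linear 'M[R[i]]_2 -> 'M[R[i]]_2})
    (noise : local_unital_noise U U')
    (diagU : forall t : R, 0 <= t -> is_diag_mx (pauli_rep (U t)))
    (diagU' : forall t : R, 0 <= t -> is_diag_mx (pauli_rep (U' t))) :
  exists (j k : 'I_4) (phi phi_perp chi chi_perp : 'cV[R[i]]_2),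
    [/\ j != ord0, k != ord0,
        pauli_eigenbasis j phi phi_perp,
        pauli_eigenbasis k chi chi_perp
      & ultimately_robust U U'
          (ketbra (max_entangled_ket phi phi_perp chi chi_perp))].
Proof.
have [chan _ _] := noise.
have ex (p : {perm 'I_3}) : exists c : 'I_4 * 'cV[R[i]]_2 * 'cV[R[i]]_2,
    [/\ c.1.1 != ord0, pauli_eigenbasis c.1.1 c.1.2 c.2 & detects (ketbra (bell c.1.2 c.2)) p].
  by have [k [x [y [k0 e d]]]] := detecting_bell R p; exists (k, x, y).
have [c hc] := fin_all_exists ex.
pose X p := ketbra (bell (c p).1.2 (c p).2).
pose L p := entanglement_lifetime U U' (X p).
have [p0 Lmax] := exists_argmax (1%g : {perm 'I_3}) L.
have [k0 eig _] := hc p0.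
exists (inord 3), (c p0).1.1, (ket1 1 0), (ket1 0 1), (c p0).1.2, (c p0).2; split=> //.
- by rewrite -val_eqE /= inordK.
- exact: eigenbasis3.
have dX : density (X p0).
  by split; [exact: psd_ketbra | have [_ _ []] := hc p0].
split; first exact: dX.
apply/eqP; rewrite eq_le; apply/andP; split.
  by apply: ereal_sup_ubound; exists (X p0).
apply: ge_ereal_sup => _ [rho drho <-]; rewrite leNgt; apply/negP => lt.
(* The infimum need not be attained, so for each test state a time [tau] is taken strictly below the
   lifetime of [rho]. *)
have tauP p : exists tau : R, [/\ 0 <= tau, forall t, tau <= t -> separable (tensmap (U t) (U' t) (X p))
    & (tau%:E < entanglement_lifetime U U' rho)%E].
  have : (L p < entanglement_lifetime U U' rho)%E by apply: le_lt_trans (Lmax p) lt.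
  by move=> /ereal_inf_lt[_ [tau [tau0 sep] <-] tlt]; exists tau.
have [tau htau] := fin_all_exists tauP.
(* From the largest of the six times on, all test outputs are separable, hence so is that of [rho]:
   its lifetime is at most this time, a contradiction. *)
have [p1 tmax] := exists_argmax (1%g : {perm 'I_3}) tau.
have [t0 _] := htau p1; rewrite ltNge => /negP; apply.
apply: ereal_inf_lbound; exists (tau p1) => //; split=> // t tt.
have t_ge0 : 0 <= t := le_trans t0 tt.
have [uU uU'] := chan t t_ge0.
apply: (@separable_all R (U t) (U' t) X) => //; [exact: diagU|exact: diagU'|..].
- by move=> p; have [] := hc p.
- by move=> p; exists (bell (c p).1.2 (c p).2).
by move=> p; have [_ + _] := htau p; apply; apply: le_trans (tmax p) tt.
Qed.
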